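(* Fix an integer $\ell\ge 3$. For every $0<\alpha_0\le 1/\ell$ there exist $\beta,\gamma>0$ and $C>0$ such that for every $\alpha$ with $\alpha_0\le\alpha\le 1/\ell$ the following holds. Let $G$ be an $n$-vertex graph with minimum degree $\delta(G)\ge(\alpha-\gamma)n$ that is $(\alpha,\beta)$-stable. If $p\ge C\log n/n$, then asymptotically almost surely $G\cup G(n,p)$ contains $\min\{\delta(G),\lfloor \alpha n\rfloor\}$ pairwise vertex-disjoint copies of $C_\ell$.
   Context: For $0<\beta<\alpha<1/2$, an $n$-vertex graph $G$ is called $(\alpha,\beta)$-stable if there is a partition $V(G)=A\cup B$ with $(\alpha-\beta)n \le |A| \le (\alpha+\beta)n$ and $(1-\alpha-\beta)n \le |B| \le (1-\alpha+\beta)n$ such that: the bipartite subgraph $G[A,B]$ (vertex set $A\cup B$, edges of $G$ between $A$ and $B$) has minimum degree at least $\alpha n/4$; all but at most $\beta n$ vertices of $A$ have at least $|B|-\beta n$ neighbours in $B$; all but at most $\beta n$ vertices of $B$ have at least $|A|-\beta n$ neighbours in $A$; and $G[B]$ has at most $\beta n^2$ edges. $C_\ell$ is the cycle on $\ell$ vertices. $G(n,p)$ is the binomial random graph on $V(G)$ (each pair an edge independently with probability $p$), and $G\cup G(n,p)$ has as edge set the union of both edge sets. ''Asymptotically almost surely'' means with probability tending to $1$ as $n\to\infty$, for any sequence $G=G_n$ satisfying the hypotheses. *)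

(* Defs.v *)
From HB Require Import structures.
From mathcomp Require Import all_boot all_order all_algebra.
From mathcomp Require Import all_classical all_reals all_analysis.
Set Implicit Arguments. Unset Strict Implicit. Unset Printing Implicit Defensive.
Import Order.TTheory GRing.Theory Num.Theory.
Local Open Scope ring_scope.

Definition simple_graph (n : nat) (G : rel 'I_n) : Prop :=
  (forall u v, G u v = G v u) /\ (forall u, ~~ G u u).

Definition deg n (G : rel 'I_n) (u : 'I_n) : nat := #|[set v | G u v]|.
Definition degin n (G : rel 'I_n) (S : {set 'I_n}) (u : 'I_n) : nat :=
  #|[set v in S | G u v]|.

(* minimum degree delta(G) (for n >= 1; default n is never attained since deg < n) *)
Definition mindeg n (G : rel 'I_n) : nat := \big[minn/n]_(u : 'I_n) deg G u.

Definition edgeset n (G : rel 'I_n) : {set {set 'I_n}} :=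
  [set [set x.1; x.2] | x in [set x : 'I_n * 'I_n | G x.1 x.2]].

Definition stable (R : realType) n (G : rel 'I_n) (alpha beta : R) : Prop :=
  exists A : {set 'I_n}, let B := ~: A in let nr := n%:R : R in
    [/\ (alpha - beta) * nr <= #|A|%:R /\ #|A|%:R <= (alpha + beta) * nr,
        (1 - alpha - beta) * nr <= #|B|%:R /\ #|B|%:R <= (1 - alpha + beta) * nr,
        (forall u, u \in A -> alpha * nr / 4 <= (degin G B u)%:R) /\
        (forall u, u \in B -> alpha * nr / 4 <= (degin G A u)%:R),
        #|[set u in A | (degin G B u)%:R < #|B|%:R - beta * nr]|%:R <= beta * nr /\
        #|[set u in B | (degin G A u)%:R < #|A|%:R - beta * nr]|%:R <= beta * nr &
        #|[set e in edgeset G | e \subset B]|%:R <= beta * nr ^+ 2].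

Definition pairs n : {set {set 'I_n}} := [set e : {set 'I_n} | #|e| == 2%N].

Definition union_graph n (G : rel 'I_n) (H : {set {set 'I_n}}) : rel 'I_n :=
  fun u v => (u != v) && (G u v || ([set u; v] \in H)).

(* G contains k pairwise vertex-disjoint copies of C_l (as subgraphs):
   an injective map f : 'I_k * 'I_l -> V such that f(i,j) ~ f(i,j+1 mod l). *)
Definition has_disjoint_cycles n (G : rel 'I_n) (k l : nat) : bool :=
  [exists f : {ffun 'I_k * 'I_l -> 'I_n},
     injectiveb f && [forall x : 'I_k * 'I_l, G (f x) (f (x.1, ordS x.2))]].

Definition prob_Gnp (R : realType) n (p : R) (E : pred {set {set 'I_n}}) : R :=
  \sum_(H : {set {set 'I_n}} | (H \subset pairs n) && E H)
     p ^+ #|H| * (1 - p) ^+ (#|pairs n| - #|H|).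

(* Main.v *)
(** Split the vertices as A (small) and B. Each cycle should use one vertex of A, joined by
  edges of G to both ends of a path with l - 1 vertices of B made of random edges. If m is
  the required number of cycles, there are k = max(m - |A|, 0) cycles inside B and
  t = max(|A| - m, 0) cycles with two vertices of A, and the count then comes out exactly.

  The random graph is used through three facts about vertex sets fixed before it is revealed,
  which makes plain union bounds over sets sufficient. (1) Any two disjoint sets of size u
  (a small multiple of n) are joined by an edge. (2) Small sets expand into each of a bounded
  number of fixed sets; with (1) and Hall's theorem this gives perfect matchings between all
  equal-sized sets containing fixed "cores", so everything can be done greedily as long as the
  cores survive, and the last step matches supersets of the cores perfectly. (3) For the
  cycles inside B: after removing vertices of linear degree in G[B], whose neighbourhoods
  contain random paths by (1), a bounded-degree part of G[B] has about k' n edges x y with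
  x in X and y in Y. Random chains X -> R_1 -> ... -> R_(l-2) are exposed first; the last edges
  between R_(l-2) and Y are independent of them, and if they do not close k' disjoint cycles,
  then all closing pairs that avoid some set of 2 k' vertices are non-edges, which is
  unlikely. *)

Require Import Defs.
From HB Require Import structures.
From mathcomp Require Import all_boot all_order all_algebra.
From mathcomp Require Import boolp.
From mathcomp Require Import zify ring lra.
Set Implicit Arguments. Unset Strict Implicit. Unset Printing Implicit Defensive.

(** * Matchings, chains and cycle families *)

Definition nbrs (V : finType) (r : rel V) (S Y : {set V}) : {set V} :=
  [set y in Y | [exists x in S, r x y]].

Definition matched (V : finType) (r : rel V) (X Y : {set V}) (f : V -> V) :=
  {in X, forall x, f x \in Y /\ r x (f x)} /\ {in X &, injective f}.

Definition joins_large (V : finType) (r : rel V) (u : nat) :=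
  forall X Y : {set V}, [disjoint X & Y] -> u <= #|X| -> u <= #|Y| ->
  exists x y, [/\ x \in X, y \in Y & r x y].

Definition expands (V : finType) (r : rel V) (W : {set V}) (e : nat) :=
  forall S : {set V}, [disjoint S & W] -> #|S| <= e -> #|S| <= #|nbrs r S W|.

Lemma nbrsP (V : finType) (r : rel V) (S Y : {set V}) y :
  reflect (y \in Y /\ exists2 x, x \in S & r x y) (y \in nbrs r S Y).
Proof.
rewrite inE; apply: (iffP andP) => -[yY].
  by case/exists_inP=> x xS rxy; split=> //; exists x.
by case=> x xS rxy; split=> //; apply/exists_inP; exists x.
Qed.

(** Hall's theorem, by induction on [#|X|]. If a nonempty proper subset [S] is tight, match [S] into
    its neighbourhood and the rest of [X] outside that neighbourhood. Otherwise any edge may be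
    used, since deleting its end in [Y] costs a proper subset at most one neighbour. *)
Lemma hall (V : finType) (r : rel V) (X Y : {set V}) :
  (forall S : {set V}, S \subset X -> #|S| <= #|nbrs r S Y|) -> exists f, matched r X Y f.
Proof.
have [n] := ubnP #|X|; elim: n X Y => // n IH X Y; rewrite ltnS => Xn HX.
have [->|/set0Pn[x xX]] := eqVneq X set0.
  by exists id; split=> x; rewrite inE.
case: (boolP [exists S : {set V}, [&& S \proper X, S != set0 & #|nbrs r S Y| <= #|S|]]).
  case/existsP=> S /and3P[SX S0 NS].
  have SsX := proper_sub SX.
  have [||f1 [f1r f1i]] := IH S (nbrs r S Y).
  - by apply: leq_trans (proper_card SX) Xn.
  - move=> S' S'S; apply: leq_trans (HX _ (subset_trans S'S SsX)) _.
    apply/subset_leq_card/subsetP=> y /nbrsP[yY [z zS' rzy]].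
    apply/nbrsP; split; last by exists z.
    by apply/nbrsP; split=> //; exists z => //; apply: (subsetP S'S).
  have [||f2 [f2r f2i]] := IH (X :\: S) (Y :\: nbrs r S Y).
  - have := cardsID S X; rewrite (setIidPr SsX).
    move: S0; rewrite -card_gt0; lia.
  - move=> S' S'XS.
    have S'X : S' \subset X by apply: subset_trans S'XS (subsetDl _ _).
    have dSS : S :&: S' = set0.
      apply/setP=> z; rewrite !inE; apply/andP=> -[zS zS'].
      by have := subsetP S'XS z zS'; rewrite inE zS.
    have := HX (S :|: S'); rewrite subUset SsX S'X => /(_ isT).
    rewrite cardsU dSS cards0 subn0 => H.
    have : nbrs r (S :|: S') Y \subset nbrs r S Y :|: nbrs r S' (Y :\: nbrs r S Y).
      apply/subsetP=> y /nbrsP[yY [z zS rzy]].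
      rewrite inE; case: (boolP (y \in nbrs r S Y)) => //= yN.
      apply/nbrsP; split; first by rewrite inE yN.
      move: zS; rewrite inE => /orP[zS|zS]; last by exists z.
      by case/negP: yN; apply/nbrsP; split=> //; exists z.
    move/subset_leq_card; have := cardsU (nbrs r S Y) (nbrs r S' (Y :\: nbrs r S Y)); lia.
  exists (fun z => if z \in S then f1 z else f2 z); split.
    move=> z zX; case: ifPn => zS.
      by have [/nbrsP[]] := f1r _ zS.
    have [|fz rz] := f2r z; first by rewrite inE zS.
    by split=> //; move: fz; rewrite inE => /andP[].
  move=> z1 z2 z1X z2X; case: ifPn => z1S; case: ifPn => z2S.
  - exact: f1i.
  - move=> E; have [y1 _] := f1r _ z1S.
    by have [|+ _] := f2r z2; rewrite !inE ?z2S // -E; move: y1; rewrite inE => /andP[-> ->].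
  - move=> E; have [y1 _] := f1r _ z2S.
    by have [|+ _] := f2r z1; rewrite !inE ?z1S // E; move: y1; rewrite inE => /andP[-> ->].
  - by apply: f2i; rewrite inE ?z1S ?z2S.
rewrite negb_exists => /forallP HS.
have [y] : exists y, y \in nbrs r [set x] Y.
  apply/set0Pn; rewrite -card_gt0.
  by apply: leq_trans (HX [set x] _); rewrite ?cards1 ?sub1set.
case/nbrsP=> yY [_ /set1P-> rxy].
have [||f [fr fi]] := IH (X :\ x) (Y :\ y).
- by have := cardsD1 x X; rewrite xX; lia.
- move=> S SX; have [->|S0] := eqVneq S set0; first by rewrite cards0.
  have SpX : S \proper X by apply: sub_proper_trans SX (properD1 xX).
  have := HS S; rewrite SpX S0 /= -ltnNge => H.
  have sub : nbrs r S Y :\ y \subset nbrs r S (Y :\ y).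
    apply/subsetP=> z; rewrite !inE => /andP[-> /andP[-> ?]] //.
  by move/subset_leq_card: sub; have := cardsD1 y (nbrs r S Y); lia.
exists (fun z => if z == x then y else f z); split.
  move=> z zX; case: eqVneq => [->//|zx].
  have [|+ ?] := fr z; first by rewrite !inE zx.
  by rewrite inE => /andP[].
move=> z1 z2 z1X z2X; case: eqVneq => [->|z1x]; case: eqVneq => [->//|z2x].
- by move=> E; have [|] := fr z2; rewrite !inE ?z2x -?E ?eqxx.
- by move=> E; have [|] := fr z1; rewrite !inE ?z1x ?E ?eqxx.
- by apply: fi; rewrite !inE ?z1x ?z2x.
Qed.

(* Small subsets of [X] expand into the core [Y0]; for a large subset [S], the set of vertices of
   [Y] not adjacent to [S] is small, so it expands into the core [X0] away from [S]. *)
Lemma robust_matching (V : finType) (r : rel V) (X Y X0 Y0 : {set V}) e :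
  symmetric r -> [disjoint X & Y] -> #|X| = #|Y| -> X0 \subset X -> Y0 \subset Y ->
  expands r X0 e -> expands r Y0 e -> joins_large r e -> exists f, matched r X Y f.
Proof.
move=> rC dXY cXY X0X Y0Y eX eY dr; apply: hall => S SX.
case: (leqP #|S| e) => Se.
  apply: leq_trans (eY _ _ Se) _.
    exact: disjointWl SX (disjointWr Y0Y dXY).
  by apply/subset_leq_card/subsetP=> y; rewrite !inE => /andP[/(subsetP Y0Y)-> ->].
have NY : nbrs r S Y \subset Y by apply/subsetP=> y; rewrite inE => /andP[].
set T := Y :\: nbrs r S Y.
have TY : T \subset Y by apply: subsetDl.
have noST x y : x \in S -> y \in T -> ~~ r x y.
  move=> xS; rewrite !inE => /andP[+ yY]; rewrite yY /= => /exists_inPn; exact.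
have Te : #|T| < e.
  rewrite ltnNge; apply/negP=> eT.
  have [|x [y [xS yT]]] := dr S T _ (ltnW Se) eT.
    exact: disjointWl SX (disjointWr TY dXY).
  by apply/negP/noST.
have NT : nbrs r T X0 \subset X :\: S.
  apply/subsetP=> x /nbrsP[xX0 [y yT ryx]]; rewrite inE (subsetP X0X) // andbT.
  by apply/negP=> xS; move: (noST _ _ xS yT); rewrite rC ryx.
have := eX T; rewrite disjoint_sym => /(_ (disjointWl X0X (disjointWr TY dXY)) (ltnW Te)).
move/subset_leq_card: NT.
have := cardsID S X; rewrite (setIidPr SX).
have := cardsID (nbrs r S Y) Y; rewrite (setIidPr NY) -/T; lia.
Qed.

Lemma subset_of_card (V : finType) (Z : {set V}) c : c <= #|Z| ->
  exists2 Z0 : {set V}, #|Z0| = c & Z0 \subset Z.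
Proof.
case/card_geqP=> s [us ss sZ]; exists [set x in s].
  by rewrite cardsE -ss; apply/card_uniqP.
by apply/subsetP=> x; rewrite inE => /sZ.
Qed.

(** By induction, at least [u] vertices of [Z] start such a path: among [2 * u] fresh vertices,
    fewer than [u] have no neighbour among the [u] or more starts found before. *)
Lemma path_inside (V : finType) (r : rel V) u j (Z : {set V}) : symmetric r -> 0 < u ->
  joins_large r u -> 0 < j -> j * (2 * u) <= #|Z| ->
  exists x p, [/\ size p = j.-1, uniq (x :: p), {subset x :: p <= Z} & path r x p].
Proof.
move=> rC u0 dr; case: j => // j _ jZ.
suff [T uT HT] : exists2 T : {set V}, u <= #|T| & {in T, forall x,
    exists p, [/\ size p = j, uniq (x :: p), {subset x :: p <= Z} & path r x p]}.
  have /set0Pn[x xT] : T != set0 by rewrite -card_gt0; lia.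
  by exists x; apply: HT.
elim: j Z jZ => [|j IH] Z jZ.
  exists Z; first lia.
  by move=> x xZ; exists [::]; split=> // y; rewrite inE => /eqP->.
have [Z0 cZ0 Z0Z] : exists2 Z0 : {set V}, #|Z0| = j.+1 * (2 * u) & Z0 \subset Z.
  by apply: subset_of_card; lia.
have [T uT HT] := IH Z0 (eq_leq (esym cZ0)).
exists (nbrs r T (Z :\: Z0)).
  rewrite leqNgt; apply/negP=> H.
  have TZ0 : T \subset Z0.
    by apply/subsetP=> x /HT[p [_ _ + _]]; apply; rewrite mem_head.
  have [||x [y [xT + rxy]]] := dr T ((Z :\: Z0) :\: nbrs r T (Z :\: Z0)) _ uT.
  - rewrite -setI_eq0; apply/eqP/setP=> z; rewrite !inE.
    case: (boolP (z \in T)) => // /(subsetP TZ0)->; by rewrite !andbF.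
  - have := cardsID (nbrs r T (Z :\: Z0)) (Z :\: Z0).
    have := cardsID Z0 Z; rewrite (setIidPr Z0Z).
    have := subset_leq_card (subsetIr (Z :\: Z0) (nbrs r T (Z :\: Z0))); nia.
  rewrite inE => /andP[/negP yN yZ]; apply: yN; apply/nbrsP; split=> //; by exists x.
move=> y /nbrsP[yZ [x xT rxy]]; have [p [sp up pZ pp]] := HT _ xT.
move: yZ; rewrite inE => /andP[yZ0 yZ].
exists (x :: p); split=> //=; first by rewrite sp.
- rewrite -/(uniq (x :: p)) up andbT; apply: contra yZ0; exact: pZ.
- move=> z; rewrite inE => /orP[/eqP->//|/pZ]; exact: (subsetP Z0Z).
- by rewrite rC rxy.
Qed.

(** * Vertex-disjoint cycles as lists, and chains of matchings *)

(** Uniqueness of the concatenation says both that no cycle repeats a vertex and that no two cycles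
    share one. *)
Definition cycle_family (V : eqType) (r : rel V) (l : nat) (cs : seq (seq V)) : bool :=
  all (fun c => (size c == l) && cycle r c) cs && uniq (flatten cs).

Definition disjoint_upto (V : finType) (D : nat -> {set V}) (j : nat) :=
  forall i i' x, i < j -> i' < j -> x \in D i -> x \in D i' -> i = i'.

(** One map serves all steps, the classes being disjoint in every use; the path from [x] in [D 0] is
    its orbit under [f]. It visits the [j + 1] classes [D 0], ..., [D j], hence the
    [disjoint_upto D j.+1] that goes with it. *)
Definition chain (V : finType) (r : rel V) (D : nat -> {set V}) (j : nat) (f : V -> V) :=
  forall i, i < j -> matched r (D i) (D i.+1) f.

Lemma cycle_family_cat (V : eqType) (r : rel V) l cs1 cs2 :
  cycle_family r l cs1 -> cycle_family r l cs2 ->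
  (forall x, x \in flatten cs1 -> x \in flatten cs2 -> False) ->
  cycle_family r l (cs1 ++ cs2).
Proof.
move=> /andP[a1 u1] /andP[a2 u2] H; rewrite /cycle_family all_cat a1 a2 /=.
rewrite flatten_cat cat_uniq u1 u2 andbT /=; apply/hasPn=> x x2.
by apply/negP=> /H; apply.
Qed.

Lemma cycle_family_cons (V : eqType) (r : rel V) l c cs :
  size c = l -> cycle r c -> uniq c -> cycle_family r l cs ->
  (forall x, x \in c -> x \in flatten cs -> False) -> cycle_family r l (c :: cs).
Proof.
move=> sc cc uc hcs H; rewrite -cat1s; apply: cycle_family_cat => //.
  by rewrite /cycle_family /= sc eqxx cc cats0.
by rewrite /= cats0.
Qed.

Lemma cycle_family_size (V : eqType) (r : rel V) l cs :
  cycle_family r l cs -> size (flatten cs) = l * size cs.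
Proof.
case/andP=> a _; elim: cs a => [|c cs IH] /=; first by rewrite muln0.
by case/andP=> /andP[/eqP sc _] /IH; rewrite size_cat sc mulnS => ->.
Qed.

Lemma uniq_flatten_nth (V : eqType) (x : V) (ss : seq (seq V)) i i' :
  uniq (flatten ss) -> x \in nth [::] ss i -> x \in nth [::] ss i' -> i = i'.
Proof.
elim: ss i i' => [|s ss IH] i i' /=; first by rewrite !nth_nil.
rewrite cat_uniq => /and3P[_ /hasPn H u].
have mem_fl j : x \in nth [::] ss j -> x \in flatten ss.
  move=> xj; apply/flattenP; exists (nth [::] ss j) => //; apply: mem_nth.
  by rewrite ltnNge; apply/negP=> /(nth_default [::]) E; rewrite E in xj.
case: i i' => [|i] [|i'] //= xi xi'.
- by have := H x (mem_fl _ xi'); rewrite /= xi.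
- by have := H x (mem_fl _ xi); rewrite /= xi'.
- by rewrite (IH i i').
Qed.

Lemma cycle_nth (V : eqType) (r : rel V) x0 (c : seq V) j : cycle r c -> j < size c ->
  r (nth x0 c j) (nth x0 c (j.+1 %% size c)).
Proof.
case: c => //= x p /(pathP x0) H jp.
have := H j; rewrite size_rcons => /(_ jp).
have -> : nth x0 (x :: rcons p x) j = nth x0 (x :: p) j.
  by rewrite -rcons_cons nth_rcons /= jp.
move: jp; rewrite ltnS leq_eqVlt => /orP[/eqP->|jp].
  by rewrite nth_rcons ltnn eqxx modnn.
by rewrite nth_rcons jp modn_small.
Qed.

Lemma flatten_map_uniq (T V : eqType) (c : T -> seq V) (s : seq T) :
  uniq s -> {in s, forall a, uniq (c a)} ->
  {in s &, forall a a' x, x \in c a -> x \in c a' -> a = a'} ->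
  uniq (flatten [seq c a | a <- s]).
Proof.
elim: s => //= a s IH /andP[as_ us] uc H; rewrite cat_uniq uc ?mem_head // IH //=.
- rewrite andbT; apply/hasPn=> x /flatten_mapP[b bs xb]; apply/negP=> xa.
  have E : a = b by apply: (H a b _ _ x) => //; rewrite ?mem_head // inE bs orbT.
  by rewrite E bs in as_.
- by move=> b bs; apply: uc; rewrite inE bs orbT.
- by move=> b b' bs bs'; apply: H; rewrite inE ?bs ?bs' orbT.
Qed.

Lemma chain_exists (V : finType) (r : rel V) (D : nat -> {set V}) j :
  disjoint_upto D j.+1 -> (forall i, i < j -> exists f, matched r (D i) (D i.+1) f) ->
  exists f, chain r D j f.
Proof.
elim: j => [|j IH] dD H; first by exists id.
have [||f Hf] := IH.
- by move=> i i' x ij i'j; apply: dD; lia.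
- by move=> i ij; apply: H; lia.
have [g Hg] := H j (ltnSn j).
exists (fun x => if x \in D j then g x else f x) => i ij.
have [->|ne] := eqVneq i j.
  case: Hg => Hg1 Hg2; split=> [x xD|x y xD yD]; rewrite ?xD ?yD; [exact: Hg1|exact: Hg2].
have E x : x \in D i -> (x \in D j) = false.
  by move=> xi; apply/negP=> xj; case/eqP: ne; apply: (dD _ _ x); lia.
have [|H1 H2] := Hf i; first lia.
by split=> [x xD|x y xD yD]; rewrite ?E //; [exact: H1|exact: H2].
Qed.

Lemma chain_iter (V : finType) (r : rel V) (D : nat -> {set V}) j f i :
  chain r D j f -> i <= j ->
  {in D 0, forall x, iter i f x \in D i} /\ {in D 0 &, injective (iter i f)}.
Proof.
move=> Hf; elim: i => [|i IH] ij; first by split=> // x y.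
have [H1 H2] := IH (ltnW ij); have [F1 F2] := Hf i ij.
split=> [x xD|x y xD yD] /=; first by have [] := F1 _ (H1 _ xD).
by move/F2 => E; apply: H2 => //; apply: E; apply: H1.
Qed.

Lemma chain_path (V : finType) (r : rel V) (D : nat -> {set V}) j f x :
  chain r D j f -> x \in D 0 -> path r x (traject f (f x) j).
Proof.
move=> Hf xD; apply/(pathP x) => i; rewrite size_traject => ij.
have -> : nth x (traject f (f x) j) i = f (iter i f x) by rewrite (set_nth_default (f x)) ?size_traject // nth_traject // -iterSr.
have -> : nth x (x :: traject f (f x) j) i = iter i f x by rewrite -[_ :: _]/(traject f x j.+1) nth_traject // ltnW.
by have [H _] := chain_iter Hf (ltnW ij); have [/(_ _ (H _ xD))[]] := Hf i ij.
Qed.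

(** Each [a] in [Z] closes the path that starts at [g a] into the cycle [a], [g a], [f (g a)], ...,
    [iter j f (g a)] of [j + 2] vertices. Both the cycles inside [B] and the final absorbing cycles
    arise this way. *)
Lemma chain_cycles (V : finType) (h r : rel V) (D : nat -> {set V}) (Z : {set V}) j f g :
  subrel h r -> disjoint_upto D j.+1 -> chain h D j f ->
  (forall i, i <= j -> [disjoint Z & D i]) -> {in Z &, injective g} ->
  {in Z, forall a, [/\ g a \in D 0, r a (g a) & r (iter j f (g a)) a]} ->
  exists cs, [/\ cycle_family r j.+2 cs, size cs = #|Z|, Z \subset flatten cs &
    {in flatten cs, forall x, x \in Z \/ exists2 i, i <= j & x \in D i}].
Proof.
move=> hr dD Hf dZ gi Hg.
pose c a := a :: traject f (g a) j.+1.
have memc a x : a \in Z -> x \in c a -> x = a \/ exists2 i, i <= j & x = iter i f (g a).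
  move=> aZ; rewrite inE => /orP[/eqP->|/trajectP[i ij ->]]; first by left.
  by right; exists i.
have ZD x i : x \in Z -> i <= j -> x \in D i -> False.
  by move=> xZ ij; apply/negP; move/disjointFr: (dZ i ij) => /(_ x xZ)->.
have itD a i : a \in Z -> i <= j -> iter i f (g a) \in D i.
  by move=> aZ ij; have [H _] := chain_iter Hf ij; apply: H; have [] := Hg _ aZ.
exists [seq c a | a <- enum Z]; split.
- apply/andP; split.
    apply/allP=> _ /mapP[a + ->]; rewrite mem_enum => aZ.
    have [gD ag ga] := Hg a aZ.
    rewrite /= size_traject eqxx /= ag /= rcons_path (sub_path hr) ?(chain_path Hf) //=.
    by rewrite last_traject.
  apply: flatten_map_uniq; first exact: enum_uniq.
    move=> a; rewrite mem_enum => aZ; rewrite cons_uniq; apply/andP; split.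
      by apply/negP=> /trajectP[i ij E]; apply: (ZD a i); rewrite // E itD.
    rewrite -[j.+1](size_traject f (g a)) (_ : traject _ _ _ = [seq iter i f (g a) | i <- iota 0 j.+1]).
      rewrite map_inj_in_uniq ?iota_uniq // => i i'; rewrite !mem_iota /= add0n !ltnS => ij i'j E.
      by apply: (dD i i' (iter i f (g a))); rewrite ?ltnS ?itD // E itD.
    apply: (@eq_from_nth _ a); rewrite !size_traject ?size_map ?size_iota // => i ij.
    by rewrite (set_nth_default (g a)) ?size_traject // nth_traject // (nth_map 0) ?size_iota ?nth_iota // add0n.
  move=> a b; rewrite !mem_enum => aZ bZ x.
  case/(memc _ _ aZ)=> [->|[i ij ->]]; case/(memc _ _ bZ)=> [E|[i' ij' E]] //.
  - by case: (ZD a i'); rewrite // E itD.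
  - by case: (ZD b i); rewrite // -E itD.
  - have E' : i = i' by apply: (dD i i' (iter i f (g a))); rewrite ?ltnS ?itD // E itD.
    subst i'; have [_ H] := chain_iter Hf ij; apply: gi => //; apply: H => //.
      by have [] := Hg a aZ.
    by have [] := Hg b bZ.
- by rewrite size_map -cardE.
- apply/subsetP=> a aZ; apply/flatten_mapP; exists a; rewrite ?mem_enum ?mem_head //.
- move=> x /flatten_mapP[a]; rewrite mem_enum => aZ /(memc _ _ aZ)[->|[i ij ->]]; first by left.
  by right; exists i => //; apply: itD.
Qed.

(** * Greedy construction of cycles *)

(** Any path on [l - 1] vertices inside the neighbourhood of [v] closes through [v], whatever its
    ends are. The term [l * size hs] pays for the cycles built before, and [Z] protects the other
    hubs and whatever is reserved for later. *)
Lemma hub_cycles (V : finType) (h r : rel V) (B Z : {set V}) u l (hs : seq V) :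
  symmetric h -> symmetric r -> subrel h r -> 0 < u -> joins_large h u -> 1 < l ->
  uniq hs -> {subset hs <= Z} ->
  {in hs, forall v, l.-1 * (2 * u) + l * size hs <= #|[set w in B | r v w] :\: Z|} ->
  exists cs, [/\ cycle_family r l cs, size cs = size hs, {subset hs <= flatten cs},
    {in flatten cs, forall x, x \in hs \/ x \in B :\: Z} &
    forall A : {set V}, [disjoint A & B] -> count (mem A) (flatten cs) = count (mem A) hs].
Proof.
move=> hC rC hr u0 hd l1; elim: hs => [|v hs IH] /=; first by exists [::].
case/andP=> vhs uhs hsZ H.
have [||| cs [ccs scs hcs mcs cA]] := IH.
- by [].
- by move=> x xh; apply: hsZ; rewrite inE xh orbT.
- by move=> x xh; apply: leq_trans (H x _); rewrite ?inE ?xh ?orbT //; lia.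
set F := [set x in flatten cs].
have cF : #|F| <= l * size hs.
  by rewrite cardsE (leq_trans (card_size _)) // (cycle_family_size ccs) scs.
have [||x [p [sp up pZ pp]]] := path_inside (j := l.-1) (Z := ([set w in B | r v w] :\: Z) :\: F) hC u0 hd.
- lia.
- have := H v (mem_head _ _).
  have := cardsID F ([set w in B | r v w] :\: Z).
  have := subset_leq_card (subsetIr ([set w in B | r v w] :\: Z) F); lia.
have vZ : v \in Z by apply: hsZ; rewrite mem_head.
have pZ' y : y \in x :: p -> [/\ y \in B, r v y, y \notin Z & y \notin flatten cs].
  by move=> /pZ; rewrite !inE => /and3P[-> -> /andP[-> ->]].
exists ((v :: x :: p) :: cs); split.
- apply: cycle_family_cons => //.
  + by rewrite /= sp; lia.
  + rewrite /= rcons_path (sub_path hr) //=.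
    have [_ -> _ _] := pZ' x (mem_head _ _).
    by have [_ + _ _] := pZ' (last x p) (mem_last _ _); rewrite rC.
  + rewrite cons_uniq up andbT; apply/negP=> /pZ'[_ _ /negP[]] //.
  + move=> y; rewrite inE => /orP[/eqP->|/pZ'[_ _ _ /negP]//].
    by case/mcs; [apply/negP|rewrite inE vZ].
- by rewrite /= scs.
- move=> y; rewrite inE => /orP[/eqP->|/hcs]; rewrite /= !inE ?eqxx // mem_cat => ->.
  by rewrite !orbT.
- move=> y; rewrite [flatten _](_ : _ = (v :: x :: p) ++ flatten cs) // mem_cat inE => /orP[/orP[/eqP->|/pZ'[yB _ yZ _]]|/mcs[]].
  + by left; rewrite mem_head.
  + by right; rewrite inE yZ.
  + by left; rewrite inE; apply/orP; right.
  + by right.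
- move=> A dAB; rewrite [flatten _](_ : _ = (v :: x :: p) ++ flatten cs) // count_cat cA //.
  suff E : count (mem A) (x :: p) = 0 by move: E => /=; clear; lia.
  apply/eqP; rewrite -leqn0 leqNgt -has_count; apply/hasPn=> y /pZ'[yB _ _ _].
  by apply/negP=> /= yA; move/disjointFr: dAB => /(_ y yA); rewrite yB.
Qed.

(** These cycles reduce a surplus of [A]: a random edge inside [A] is completed by a path on [l - 2]
    vertices in the common neighbourhood of its ends. The [4 * u] is the room that [path_inside]
    needs for a path on two vertices. *)
Lemma two_vertex_cycles (V : finType) (h r : rel V) (A B : {set V}) u l t :
  symmetric h -> symmetric r -> subrel h r -> 0 < u -> joins_large h u -> 2 < l ->
  [disjoint A & B] -> 4 * u + l * t <= #|A| ->
  {in A &, forall a a', (l - 2) * (2 * u) + l * t <= #|[set w in B | r a w && r a' w]|} ->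
  exists cs, [/\ cycle_family r l cs, size cs = t, {subset flatten cs <= A :|: B} &
    count (mem A) (flatten cs) = 2 * t].
Proof.
move=> hC rC hr u0 hd l2 dAB; elim: t => [|t IH] cA cB; first by exists [::].
have [||cs [ccs scs mcs nA]] := IH.
- by lia.
- by move=> a a' aA a'A; apply: leq_trans (cB a a' aA a'A); lia.
set F := [set x in flatten cs].
have cF : #|F| <= l * t by rewrite cardsE (leq_trans (card_size _)) // (cycle_family_size ccs) scs.
have [||a [p0 [sp ua aA pa]]] := path_inside (j := 2) (Z := A :\: F) hC u0 hd.
- by [].
- by have := cardsID F A; have := subset_leq_card (subsetIr A F); lia.
case: p0 sp ua aA pa => [|a' [|? ?]] // _ ua aA pa.
have [aA' aF] : a \in A /\ a \notin flatten cs.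
  by have := aA a; rewrite mem_head !inE => /(_ isT)/andP[].
have [a'A a'F] : a' \in A /\ a' \notin flatten cs.
  by have := aA a'; rewrite !inE eqxx orbT => /(_ isT)/andP[].
have haa : r a a' by apply: hr; case/andP: pa.
have naa : a != a' by move: ua; rewrite /= inE andbT.
set W := [set w in B | r a w && r a' w].
have [||x [p [sp' up pZ pp]]] := path_inside (j := l - 2) (Z := W :\: F) hC u0 hd.
- by rewrite subn_gt0.
- have := cB a a' aA' a'A; rewrite -/W.
  by have := cardsID F W; have := subset_leq_card (subsetIr W F); move: cF; clear; lia.
have pZ' y : y \in x :: p -> [/\ y \in B, r a y, r a' y & y \notin flatten cs].
  by move/pZ; rewrite !inE => /andP[-> /and3P[-> -> ->]].
have BA y : y \in B -> y \notin A.
  by move=> yB; apply/negP=> yA; move/disjointFr: dAB => /(_ y yA); rewrite yB.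
have E : flatten ((a :: a' :: x :: p) :: cs) = (a :: a' :: x :: p) ++ flatten cs by [].
exists ((a :: a' :: x :: p) :: cs); split.
- apply: cycle_family_cons => //.
  + by rewrite /= sp'; move: l2; clear; lia.
  + rewrite /= haa rcons_path (sub_path hr) //=.
    have [_ _ -> _] := pZ' x (mem_head _ _).
    by have [_ + _ _] := pZ' (last x p) (mem_last _ _); rewrite rC.
  + rewrite 2!cons_uniq up andbT inE negb_or naa /=.
    apply/andP; split; apply/negP=> /pZ'[/BA/negP]; by [].
  + by move=> y; rewrite !inE -in_cons => /or3P[/eqP->|/eqP->|/pZ'[_ _ _]]; apply/negP.
- by rewrite /= scs.
- move=> y; rewrite E mem_cat !inE -in_cons => /orP[/or3P[/eqP->|/eqP->|/pZ'[-> _ _ _]]|/mcs].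
  + by rewrite aA'.
  + by rewrite a'A.
  + by rewrite orbT.
  + by rewrite inE.
- rewrite E count_cat nA [count _ (a :: _)]/= aA' a'A.
  suff -> : (x \in A) + count (mem A) p = 0 by clear; lia.
  apply/eqP; rewrite -[_ + _]/(count (mem A) (x :: p)) -leqn0 leqNgt -has_count.
  by apply/hasPn=> y /pZ'[/BA].
Qed.

Lemma subset_between_card (V : finType) (C W : {set V}) c : C \subset W -> #|C| <= c <= #|W| ->
  exists Z : {set V}, [/\ C \subset Z, Z \subset W & #|Z| = c].
Proof.
move=> CW /andP[Cc cW].
have [|Z0 cZ0 Z0W] := @subset_of_card _ (W :\: C) (c - #|C|).
  by have := cardsID C W; rewrite (setIidPr CW); lia.
exists (C :|: Z0); split; first exact: subsetUl.
  by rewrite subUset CW (subset_trans Z0W) // subsetDl.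
rewrite cardsU (_ : C :&: Z0 = set0) ?cards0; first lia.
apply/setP=> x; rewrite !inE; apply/andP=> -[xC /(subsetP Z0W)]; by rewrite inE xC.
Qed.

(** The last class is filled up outside the other cores; the remaining classes are then built
    outside it. *)
Lemma extend_disjoint_sets (V : finType) (C : nat -> {set V}) j N (W : {set V}) :
  (forall i, i < j -> C i \subset W /\ #|C i| <= N) -> disjoint_upto C j -> j * N <= #|W| ->
  exists2 D : nat -> {set V},
    (forall i, i < j -> [/\ C i \subset D i, D i \subset W & #|D i| = N]) & disjoint_upto D j.
Proof.
elim: j W => [|j IH] W HC dC jN; first by exists C.
pose U := \bigcup_(i < j) C i.
have cU : #|U| <= j * N.
  rewrite -[j in j * N]card_ord -sum_nat_const /U.
  apply: (@leq_trans (\sum_(i < j) #|C i|)).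
    apply: (big_ind2 (fun (X : {set V}) n => #|X| <= n)); rewrite ?cards0 //.
    by move=> X n Y m hX hY; rewrite cardsU; lia.
  by apply: leq_sum => i _; have [] := HC i (ltnW (ltn_ord i)).
have UP x : reflect (exists2 i, i < j & x \in C i) (x \in U).
  apply: (iffP bigcupP) => [[i _ xi]|[i ij xi]]; first by exists i.
  by exists (Ordinal ij).
have [CjW cCj] := HC j (ltnSn j).
have CjU : C j \subset W :\: U.
  apply/subsetP=> x xj; rewrite inE (subsetP CjW) // andbT; apply/UP=> -[i ij xi].
  by have := dC i j x _ _ xi xj; lia.
have [|Dj [CD DW cD]] := subset_between_card (c := N) CjU.
  by rewrite cCj; have := cardsID U W; have := subset_leq_card (subsetIr W U); lia.
have DU x : x \in Dj -> x \notin U by move/(subsetP DW); rewrite inE => /andP[].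
have DjW : Dj \subset W by apply: subset_trans DW (subsetDl _ _).
have [|||D HD dD] := IH (W :\: Dj).
- move=> i ij; have [CW cC] := HC i (ltnW ij); split=> //.
  apply/subsetP=> x xi; rewrite inE (subsetP CW) // andbT.
  by apply/negP=> /DU/UP[]; exists i.
- by move=> i i' x ij i'j; apply: dC; lia.
- by have := cardsID Dj W; rewrite (setIidPr DjW) cD; lia.
exists (fun i => if i < j then D i else Dj).
  move=> i; case: ifP => [ij _|ij ij1].
    have [CDi + cDi] := HD i ij; split=> //; apply: subset_trans; first by eassumption.
    exact: subsetDl.
  by have -> : i = j by lia.
move=> i i' x ij i'j; case: ifPn => ij1; case: ifPn => ij2.
- exact: dD.
- move=> xi xj; have [_ /subsetP/(_ _ xi) + _] := HD i ij1.
  by rewrite inE xj.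
- move=> xj xi; have [_ /subsetP/(_ _ xi) + _] := HD i' ij2.
  by rewrite inE xj.
- lia.
Qed.

(** * Edge counts, cuts and vertex covers *)

(** Ordered pairs are counted, so for a symmetric irreflexive [r] each edge inside [S] counts twice
    in [edges r S S]. *)
Definition edges (V : finType) (r : rel V) (X Y : {set V}) : nat :=
  \sum_(x in X) \sum_(y in Y) r x y.

Lemma card_degree (V : finType) (r : rel V) (Y : {set V}) x :
  #|[set y in Y | r x y]| = \sum_(y in Y) r x y.
Proof. by rewrite -sum1dep_card big_mkcondr /=; apply: eq_bigr => y _; case: (r x y). Qed.

Lemma edges_sym (V : finType) (r : rel V) X Y : symmetric r -> edges r X Y = edges r Y X.
Proof.
by move=> rC; rewrite /edges exchange_big; apply: eq_bigr => x _; apply: eq_bigr => y _; rewrite rC.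
Qed.

Lemma sum_setU (V : finType) (A B : {set V}) (F : V -> nat) : [disjoint A & B] ->
  \sum_(x in A :|: B) F x = \sum_(x in A) F x + \sum_(x in B) F x.
Proof.
move=> dAB; rewrite (big_setID A) /= setUK setDUl setDv set0U.
by congr (_ + _); apply: eq_bigl; move: dAB; rewrite disjoint_sym => /setDidPl->.
Qed.

Lemma edgesUl (V : finType) (r : rel V) (X1 X2 Y : {set V}) : [disjoint X1 & X2] ->
  edges r (X1 :|: X2) Y = edges r X1 Y + edges r X2 Y.
Proof. by move=> d; exact: sum_setU. Qed.

Lemma edgesUr (V : finType) (r : rel V) (X Y1 Y2 : {set V}) : [disjoint Y1 & Y2] ->
  edges r X (Y1 :|: Y2) = edges r X Y1 + edges r X Y2.
Proof. by move=> d; rewrite /edges -big_split; apply: eq_bigr => x _; rewrite sum_setU. Qed.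

(** Adding each vertex to the side opposite to most of its neighbours makes at least half of the
    edges cross. The factor is 4 because [edges r S S] counts every edge twice. *)
Lemma half_cut (V : finType) (r : rel V) (S : {set V}) : symmetric r -> irreflexive r ->
  exists S1 S2, [/\ S = S1 :|: S2, [disjoint S1 & S2] & edges r S S <= 4 * edges r S1 S2].
Proof.
move=> rC rI; have [n] := ubnP #|S|; elim: n S => // n IH S; rewrite ltnS => Sn.
have [->|/set0Pn[v vS]] := eqVneq S set0.
  by exists set0, set0; rewrite setU0 -setI_eq0 set0I eqxx /edges big_set0.
have [|S1 [S2 [E d12 H]]] := IH (S :\ v); first by have := cardsD1 v S; rewrite vS; lia.
have vE : v \notin S1 :|: S2 by rewrite -E !inE eqxx.
move: (vE); rewrite inE negb_or => /andP[v1 v2].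
have dv (T : {set V}) : v \notin T -> [disjoint [set v] & T] by rewrite disjoints1.
have e1 : edges r S S = edges r (S :\ v) (S :\ v) + 2 * edges r [set v] (S :\ v).
  have dS := dv (S :\ v) ltac:(by rewrite !inE eqxx).
  rewrite -{1 2}(setD1K vS) edgesUl // !edgesUr // [edges r (S :\ v) [set v]]edges_sym //.
  have -> : edges r [set v] [set v] = 0 by rewrite /edges !big_set1 rI.
  lia.
have e2 : edges r [set v] (S :\ v) = edges r [set v] S1 + edges r [set v] S2.
  by rewrite E edgesUr.
case: (leqP (edges r [set v] S1) (edges r [set v] S2)) => H12.
- exists (v |: S1), S2; split.
  + by rewrite -setUA -E setD1K.
  + by rewrite -setI_eq0 setIUl setU_eq0 !setI_eq0 disjoints1 v2.
  + by rewrite edgesUl ?dv //; lia.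
- exists S1, (v |: S2); split.
  + by rewrite setUCA -E setD1K.
  + by rewrite -setI_eq0 setIUr setU_eq0 !setI_eq0 disjoint_sym disjoints1 v1.
  + by rewrite edgesUr ?dv // [edges r S1 [set v]]edges_sym //; lia.
Qed.

Lemma edges_le (V : finType) (r : rel V) (X Y : {set V}) D :
  {in X, forall x, #|[set y in Y | r x y]| <= D} -> edges r X Y <= #|X| * D.
Proof.
by move=> H; rewrite -sum_nat_const; apply: leq_sum => x xX; rewrite -card_degree H.
Qed.

Lemma edges_ge (V : finType) (r : rel V) (X Y : {set V}) k :
  {in X, forall x, k <= #|[set y in Y | r x y]|} -> #|X| * k <= edges r X Y.
Proof.
by move=> H; rewrite -sum_nat_const; apply: leq_sum => x xX; rewrite -card_degree H.
Qed.

(** Each vertex of [U] is incident to at most [D] of the counted edges. *)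
Lemma edges_setD (V : finType) (r : rel V) (X Y U : {set V}) D c :
  symmetric r -> [disjoint X & Y] ->
  {in X, forall x, #|[set y in Y | r x y]| <= D} ->
  {in Y, forall y, #|[set x in X | r y x]| <= D} -> #|U| <= c ->
  edges r X Y <= edges r (X :\: U) (Y :\: U) + c * D.
Proof.
move=> rC dXY HX HY cU.
have dI (Z : {set V}) : [disjoint Z :&: U & Z :\: U].
  by rewrite -setI_eq0; apply/eqP/setP=> z; rewrite !inE; case: (z \in U); rewrite ?andbF.
have -> : edges r X Y = edges r (X :&: U) Y + edges r (X :\: U) Y.
  by rewrite -edgesUl ?dI // setID.
have -> : edges r (X :\: U) Y = edges r (X :\: U) (Y :&: U) + edges r (X :\: U) (Y :\: U).
  by rewrite -edgesUr ?dI // setID.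
have h1 : edges r (X :&: U) Y <= #|X :&: U| * D.
  by apply: edges_le => x; rewrite inE => /andP[/HX].
have h2 : edges r (X :\: U) (Y :&: U) <= #|Y :&: U| * D.
  rewrite edges_sym //; apply: edges_le => y; rewrite inE => /andP[/HY H _].
  apply: leq_trans H; apply/subset_leq_card/subsetP=> x; rewrite !inE.
  by case/andP=> /andP[_ ->].
have : #|X :&: U| + #|Y :&: U| <= #|U|.
  rewrite -cardsUI (_ : (X :&: U) :&: (Y :&: U) = set0) ?cards0 ?addn0.
    by apply: subset_leq_card; rewrite -setIUl subsetIr.
  by apply/eqP; rewrite setI_eq0; apply: disjointWl (subsetIl _ _) (disjointWr (subsetIl _ _) dXY).
nia.
Qed.

(** The hubs are vertices of degree at least [D] inside [B]. If there are fewer than [k], the other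
    vertices still send [k'] edges each to non-hubs, and cuts turn these edges into a bipartite
    graph of bounded degree between [X] and [Y]. The set [Q] is a reservoir disjoint from both. *)
Lemma hub_or_sparse (V : finType) (r : rel V) (B : {set V}) k e D :
  symmetric r -> irreflexive r -> e + k <= #|B| ->
  {in B, forall x, k <= #|[set y in B | r x y]|} ->
  exists (hubs X Y Q : {set V}) (k' : nat),
  [/\ [/\ hubs \subset B, #|hubs| + k' = k & {in hubs, forall x, D <= #|[set y in B | r x y]|}],
      [/\ X \subset B :\: hubs, Y \subset B :\: hubs & Q \subset B :\: hubs],
      [/\ [disjoint X & Y], [disjoint X & Q] & [disjoint Y & Q]],
      [/\ #|X| <= e, {in X, forall x, #|[set y in Y | r x y]| <= D} &
          {in Y, forall y, #|[set x in X | r y x]| <= D}] &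
      k' * e <= 8 * edges r X Y /\ #|B| <= 2 * #|Q| + e + k + 1].
Proof.
move=> rC rI ekB degB.
pose Big := [set x in B | D <= #|[set y in B | r x y]|].
have BigB : Big \subset B by apply/subsetP=> x; rewrite inE => /andP[].
case: (leqP k #|Big|) => kBig.
  have [H cH HBig] := subset_of_card kBig.
  have HB := subset_trans HBig BigB.
  exists H, set0, set0, (B :\: H), 0; split; rewrite ?sub0set ?subxx ?cards0 ?addn0 //.
  - by split=> // x /(subsetP HBig); rewrite inE => /andP[].
  - by rewrite -!setI_eq0 !set0I.
  - by split=> // x; rewrite inE.
  - by have := cardsID H B; rewrite (setIidPr HB) cH; split=> //; lia.
have cV : #|B :\: Big| = #|B| - #|Big| by have := cardsID Big B; rewrite (setIidPr BigB); lia.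
have [|S cS SV] := @subset_of_card _ (B :\: Big) e; first by lia.
have cO : #|(B :\: Big) :\: S| = #|B| - #|Big| - e.
  by have := cardsID S (B :\: Big); rewrite (setIidPr SV); lia.
have degV : {in B :\: Big, forall x, k - #|Big| <= #|[set y in B :\: Big | r x y]|}.
  move=> x; rewrite inE => /andP[_ xB]; have := degB x xB.
  have : [set y in B | r x y] \subset Big :|: [set y in B :\: Big | r x y].
    by apply/subsetP=> y; rewrite !inE => /andP[yB ->]; rewrite yB; case: leqP.
  by move/subset_leq_card; have := cardsU Big [set y in B :\: Big | r x y]; lia.
have smallV x : x \in B :\: Big -> #|[set y in B | r x y]| <= D.
  by rewrite !inE => /andP[+ xB]; rewrite xB /= -ltnNge => /ltnW.
have smallVT x (T : {set V}) : x \in B :\: Big -> T \subset B -> #|[set y in T | r x y]| <= D.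
  move=> /smallV xD TB; apply: leq_trans xD.
  by apply/subset_leq_card/subsetP=> y; rewrite !inE => /andP[/(subsetP TB)-> ->].
set O := (B :\: Big) :\: S in cO.
have [S1 [S2 [E12 d12 cut]]] := half_cut S rC rI.
have dSO : [disjoint S & O].
  by rewrite -setI_eq0; apply/eqP/setP=> z; rewrite !inE; case: (z \in S); rewrite ?andbF.
have eSO : (k - #|Big|) * e <= edges r S S + edges r S O.
  rewrite -edgesUr // /O (_ : S :|: _ = B :\: Big).
    by rewrite mulnC -cS; apply: edges_ge => x /(subsetP SV)/degV.
  by rewrite -{1}(setIidPr SV) setID.
have S1S : S1 \subset S by rewrite E12 subsetUl.
have S2S : S2 \subset S by rewrite E12 subsetUr.
(* [X] is the side of the cut of [S] that sends more edges to [O], which loses a factor 2 on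
   [edges r S O]; the cut loses 4 on [edges r S S]. *)
have [X [X' [XS X'S dXX' eX]]] : exists X X' : {set V}, [/\ X \subset S, X' \subset S,
    [disjoint X & X'] & (k - #|Big|) * e <= 4 * (edges r X X' + edges r X O)].
  have eO : edges r S O = edges r S1 O + edges r S2 O by rewrite E12 edgesUl.
  case: (leqP (edges r S2 O) (edges r S1 O)) => HO.
    by exists S1, S2; split=> //; lia.
  by exists S2, S1; rewrite disjoint_sym; split=> //; rewrite (edges_sym S2 S1 rC); lia.
have [c [cO1' cO2']] : exists c, 2 * c <= #|O| /\ #|O| <= 2 * c + 1.
  exists #|O|./2; have := odd_double_half #|O|; rewrite -muln2; clear.
  by case: (odd _) => /= <-; split; lia.
have [|O1 cO1 O1O] := @subset_of_card _ O c; first by clear -cO1'; lia.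
have dO : [disjoint O1 & O :\: O1].
  by rewrite -setI_eq0; apply/eqP/setP=> z; rewrite !inE; case: (z \in O1); rewrite ?andbF.
have cO2 : #|O :\: O1| = #|O| - c by have := cardsID O1 O; rewrite (setIidPr O1O); clear -cO1; lia.
(* [O] is halved: the half receiving more edges from [X] joins [Y], and the other half becomes the
   reservoir. This loses another factor 2, whence the 8 in the statement. *)
have [Q [Q' [QO Q'O dQ eQ cQ]]] : exists Q Q' : {set V}, [/\ Q \subset O, Q' \subset O,
    [disjoint Q & Q'], edges r X O <= 2 * edges r X Q' & #|O| <= 2 * #|Q| + 1].
  have eO : edges r X O = edges r X O1 + edges r X (O :\: O1).
    by rewrite -edgesUr // -{1}(setIidPr O1O) setID.
  case: (leqP (edges r X O1) (edges r X (O :\: O1))) => HO.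
    by exists O1, (O :\: O1); split; rewrite ?subsetDl //; clear -eO HO cO1 cO2'; lia.
  by exists (O :\: O1), O1; rewrite disjoint_sym; split; rewrite ?subsetDl //; clear -eO HO cO2 cO1'; lia.
have dX'Q' : [disjoint X' & Q'] by apply: disjointWl X'S (disjointWr Q'O dSO).
have OV : O \subset B :\: Big by apply: subsetDl.
have XV := subset_trans XS SV; have X'V := subset_trans X'S SV.
have QV := subset_trans QO OV; have Q'V := subset_trans Q'O OV.
have VB : B :\: Big \subset B by apply: subsetDl.
have YV : X' :|: Q' \subset B :\: Big by rewrite subUset X'V.
exists Big, X, (X' :|: Q'), Q, (k - #|Big|); split.
- by split=> //; [exact: subnKC (ltnW kBig) | move=> x; rewrite inE => /andP[]].
- by split.
- rewrite -!setI_eq0 setIUr setIUl !setU_eq0 !setI_eq0 dXX'; split.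
  + exact: disjointWl XS (disjointWr Q'O dSO).
  + exact: disjointWl XS (disjointWr QO dSO).
  + by rewrite (disjointWl X'S (disjointWr QO dSO)) disjoint_sym.
- split.
  + by rewrite -cS subset_leq_card.
  + by move=> x /(subsetP XV) xV; apply: smallVT => //; apply: subset_trans YV VB.
  + by move=> x /(subsetP YV) xV; apply: smallVT => //; apply: subset_trans XV VB.
- rewrite edgesUr //; split; first by move: eX eQ; move: (_ * e) => pe; clear; lia.
  by clear -cQ cO kBig; lia.
Qed.

(* Otherwise the vertices of a maximal matching would form a cover with at most [2 * k]
   vertices. *)
Lemma matching_of_no_small_cover (V : finType) (J : rel V) (X Y : {set V}) k :
  (forall U : {set V}, #|U| <= 2 * k -> exists x y, [/\ x \in X :\: U, y \in Y :\: U & J x y]) ->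
  exists (Z : {set V}) g, [/\ Z \subset Y, #|Z| = k, {in Z &, injective g} &
    {in Z, forall y, g y \in X /\ J (g y) y}].
Proof.
elim: k => [|k IH] H.
  by exists set0, id; split; rewrite ?sub0set ?cards0 // => x; rewrite inE.
have [|Z [g [ZY cZ gi HZ]]] := IH; first by move=> U cU; apply: H; lia.
have [|x [y [xU yU Jxy]]] := H (Z :|: g @: Z).
  by have := cardsU Z (g @: Z); have := leq_imset_card g Z; lia.
move: xU yU; rewrite !inE !negb_or => /andP[/andP[_ xg] xX] /andP[/andP[yZ _] yY].
exists (y |: Z), (fun z => if z == y then x else g z); split.
- by rewrite subUset sub1set yY.
- by rewrite cardsU1 yZ cZ.
- move=> z1 z2; rewrite !inE; case: eqVneq => [->|z1y] /= z1Z; case: eqVneq => [->//|z2y] /= z2Z.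
  + by move=> E; case/negP: xg; rewrite E imset_f.
  + by move=> E; case/negP: xg; rewrite -E imset_f.
  + exact: gi.
- by move=> z; rewrite !inE; case: eqVneq => [->//|_] /= /HZ.
Qed.

(** * Deterministic assembly of the cycles *)

(** The final step, which covers all of [A]: the cores are enlarged to classes of size [#|A|] linked
    by perfect matchings, and Hall's theorem assigns to each vertex of [A] a path both of whose ends
    are adjacent to it in [G]. *)
Lemma absorbing_cycles (V : finType) (h G r : rel V) (A W T : {set V})
    (C : nat -> {set V}) j u b :
  symmetric h -> symmetric r -> symmetric G -> subrel h r -> subrel G r -> 0 < j ->
  [disjoint A & W] -> joins_large h u ->
  (forall i, i <= j -> [/\ C i \subset W :\: T, #|C i| <= 2 * u & expands h (C i) u]) ->
  disjoint_upto C j.+1 -> #|T| <= b -> 2 * u + b <= #|A| -> j.+1 * #|A| <= #|W| ->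
  {in A, forall a, #|[set w in W | ~~ G a w]| <= b} ->
  {in W :\: T, forall w, #|[set a in A | ~~ G w a]| <= b} ->
  {in W, forall w, 3 * b < #|[set a in A | G w a]|} ->
  exists cs, [/\ cycle_family r j.+2 cs, size cs = #|A| & {subset flatten cs <= A :|: W}].
Proof.
move=> hC rC GC hr Gr j0 dAW hd HC dC cT cA cW missA missW degW.
(* Putting the atypical vertices [T] in the first class makes the other classes, hence the
   last one, consist of typical vertices. *)
pose C' i := if i == 0 then C 0 :|: (T :&: W) else C i.
have CC' i : C i \subset C' i.
  by rewrite /C'; case: eqP => [->|_]; rewrite ?subsetUl ?subxx.
have C'C i x : i <= j -> x \in C' i -> x \in C i \/ i = 0 /\ x \in T.
  by move=> ij; rewrite /C'; case: eqP => [->|_]; [rewrite !inE => /orP[|/andP[]]|]; tauto.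
have CnT i x : i <= j -> x \in C i -> x \notin T.
  by move=> ij xC; have [/subsetP/(_ x xC) + _ _] := HC i ij; rewrite inE => /andP[].
have [||| D HD dD] := @extend_disjoint_sets _ C' j.+1 #|A| W.
- move=> i ij; have [CW cC _] := HC i ij.
  have CW' : C i \subset W by apply: subset_trans CW (subsetDl _ _).
  rewrite /C'; case: eqP => [i0|_]; last by split=> //; lia.
  subst i; rewrite subUset CW' subsetIr; split=> //.
  by have := cardsU (C 0) (T :&: W); have := subset_leq_card (subsetIl T W); lia.
- move=> i i' x ij i'j /C'C-/(_ ij)[xi|[-> xT]] /C'C-/(_ i'j)[xi'|[-> xT']] //.
  + exact: (dC i i' x).
  + by move: (CnT _ _ ij xi); rewrite xT'.
  + by move: (CnT _ _ i'j xi'); rewrite xT.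
- by [].
have DW i : i <= j -> D i \subset W by move=> ij; have [] := HD i ij.
have [f Hf] : exists f, chain h D j f.
  apply: chain_exists => // i ij.
  have [CD1 _ cD1] := HD i (ltnW ij : i < j.+1); have [CD2 _ cD2] := HD i.+1 ij.
  have [_ _ ex1] := HC i (ltnW ij); have [_ _ ex2] := HC i.+1 ij.
  apply: (robust_matching (X0 := C i) (Y0 := C i.+1) (e := u)) => //; rewrite ?cD1 ?cD2 //.
  - rewrite -setI_eq0; apply/eqP/setP=> x; rewrite !inE; apply/andP=> -[x1 x2].
    by have := dD i i.+1 x; lia.
  - exact: subset_trans (CC' _) CD1.
have [fD fi] := chain_iter Hf (leqnn j).
have [D0C D0W cD0] := HD 0 isT.
pose s a d := G a d && G (iter j f d) a.
have [g [Hg gi]] : exists g, matched s A (D 0) g.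
  apply: hall => S SA.
  have [->|/set0Pn[a aS]] := eqVneq S set0; first by rewrite cards0.
  have aA := subsetP SA a aS.
  (* For such [S] a single vertex suffices: it misses at most [b] first ends and at most [b] last
     ends of the paths. *)
  case: (leqP #|S| (#|A| - 2 * b)) => cS.
    apply: leq_trans cS _.
    pose M := [set w in W | ~~ G a w].
    have cM : #|M| <= b by apply: missA.
    pose M2 := [set d in D 0 | iter j f d \in M].
    have cM2 : #|M2| <= b.
      apply: leq_trans cM; rewrite -(card_in_imset (f := iter j f) (D := mem M2)).
        by apply/subset_leq_card/subsetP=> _ /imsetP[d + ->]; rewrite inE => /andP[].
      by move=> x y; rewrite !inE => /andP[xD _] /andP[yD _]; apply: fi.
    have : D 0 \subset nbrs s S (D 0) :|: (M :|: M2).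
      apply/subsetP=> d dD0; rewrite inE orbC -implyNb; apply/implyP.
      rewrite !inE dD0 (subsetP D0W) //= negb_or !negbK => /andP[Gad].
      have fd : iter j f d \in W by apply: (subsetP (DW j _)) => //; apply: fD.
      rewrite fd /= negbK => Gaf; apply/exists_inP; exists a => //.
      by rewrite /s Gad GC.
    move/subset_leq_card; rewrite cD0.
    by have := cardsU (nbrs s S (D 0)) (M :|: M2); have := cardsU M M2; lia.
  (* A larger [S] meets every common neighbourhood: [d] has more than [3 * b] neighbours in [A], and
     the last end of its path, being typical, misses at most [b] of them. *)
  suff <- : D 0 = nbrs s S (D 0) by rewrite cD0 subset_leq_card.
  apply/setP=> d; rewrite inE; case: (boolP (d \in D 0)) => //= dD0; symmetry.
  have dW := subsetP D0W d dD0.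
  have fdD := fD d dD0; set c := iter j f d in fdD.
  have cWT : c \in W :\: T.
    rewrite inE (subsetP (DW j _)) // andbT; apply/negP=> cT'.
    suff : 0 = j by move=> E; rewrite -E in j0.
    apply: (dD 0 j c) => //; apply: (subsetP D0C); rewrite /C' eqxx !inE cT' (subsetP (DW j _)) //.
    by rewrite orbT.
  have := missW c cWT; have := degW d dW.
  set N1 := [set _ in A | _]; set N2 := [set _ in A | _] => c1 c2.
  have cN : b * 2 < #|N1 :\: N2|.
    by have := cardsID N2 N1; have := subset_leq_card (subsetIr N1 N2); move: c1 c2; clear; lia.
  have N1A : N1 :\: N2 \subset A by apply/subsetP=> x; rewrite !inE => /and3P[].
  have /set0Pn[x] : S :&: (N1 :\: N2) != set0.
    rewrite -card_gt0; have := cardsUI S (N1 :\: N2).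
    have : #|S :|: (N1 :\: N2)| <= #|A| by rewrite subset_leq_card // subUset SA.
    have := subset_leq_card N1A; move: cS cN; clear; lia.
  rewrite !inE => /and3P[xS + /andP[xA Gdx]]; rewrite xA /= negbK => Gcx.
  by apply/exists_inP; exists x => //; rewrite /s GC Gdx.
have [|||cs [ccs scs _ mcs]] := chain_cycles (Z := A) (g := g) hr dD Hf.
- by move=> i ij; apply: disjointWr (DW i ij) dAW.
- exact: gi.
- by move=> a /Hg[gD /andP[G1 G2]]; split=> //; apply: Gr.
exists cs; split=> // x /mcs[xA|[i ij /(subsetP (DW i ij)) xW]]; rewrite inE ?xA //.
by rewrite xW orbT.
Qed.

(** A vertex [y] of [Y] is joined to [x] by an edge of [G], and the path from [x] returns to [y] by
    a random edge. The hypothesis on [U] says that the pairs [(x, y)] that close have no small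
    cover, so they contain a matching of size [k]. *)
Lemma inner_cycles (V : finType) (h G r : rel V) (D : nat -> {set V}) (Y : {set V})
    j k f :
  symmetric G -> subrel h r -> subrel G r -> disjoint_upto D j.+1 -> chain h D j f ->
  (forall i, i <= j -> [disjoint Y & D i]) ->
  (forall U : {set V}, #|U| <= 2 * k ->
     exists x y, [/\ x \in D 0 :\: U, y \in Y :\: U, G x y & h (iter j f x) y]) ->
  exists cs, [/\ cycle_family r j.+2 cs, size cs = k &
    {in flatten cs, forall x, x \in Y \/ exists2 i, i <= j & x \in D i}].
Proof.
move=> GC hr Gr dD Hf dY HU.
have [U /HU[x [y [xD yY Gxy hxy]]]|Z [g [ZY cZ gi Hg]]] := @matching_of_no_small_cover _
    [rel x y | G x y && h (iter j f x) y] (D 0) Y k.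
  by exists x, y; rewrite /= Gxy.
have [|||cs [ccs scs _ mcs]] := chain_cycles (Z := Z) (g := g) hr dD Hf.
- by move=> i ij; apply: disjointWl ZY (dY i ij).
- exact: gi.
- by move=> y /Hg[gD /andP[G1 h1]]; split=> //; [apply: Gr; rewrite GC | apply: hr].
exists cs; split=> //; first by rewrite scs.
by move=> x /mcs[/(subsetP ZY)|]; [left|right].
Qed.

Lemma card_flatten (V : finType) (r : rel V) l cs : cycle_family r l cs ->
  #|[set x in flatten cs]| = l * size cs.
Proof.
move=> ccs; rewrite cardsE -(cycle_family_size ccs); apply/card_uniqP.
by case/andP: ccs.
Qed.

Lemma card_flattenI (V : finType) (r : rel V) l cs (A : {set V}) : cycle_family r l cs ->
  #|A :&: [set x in flatten cs]| = count (mem A) (flatten cs).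
Proof.
case/andP=> _ u; rewrite -size_filter -(card_uniqP (filter_uniq _ u)).
by apply: eq_card => x; rewrite !inE mem_filter.
Qed.

(* [H] consists of vertices of large degree in [G[B]] and [cs0] of cycles inside [B :\: H]; each
   vertex of [H] and each atypical vertex of [A] gets its own cycle. *)
Lemma cycles_assembly (V : finType) (h G r : rel V) (A B H : {set V}) (C : nat -> {set V})
    j u b k k' t m cs0 (Aty := [set x in A | #|[set y in B | G x y]| + b < #|B|])
    (Bty := [set x in B | #|[set y in A | G x y]| + b < #|A|]) :
  symmetric h -> symmetric r -> symmetric G -> subrel h r -> subrel G r -> 0 < j -> 0 < u ->
  joins_large h u -> [disjoint A & B] -> A :|: B = setT -> 20 * j.+2 * b <= u ->
  {in A, forall x, 16 * j.+2 * u <= #|[set y in B | G x y]|} ->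
  {in B, forall x, 16 * j.+2 * u <= #|[set y in A | G x y]|} ->
  48 * j.+2 * u <= #|A| -> 48 * j.+2 * u <= #|B| ->
  #|Aty| <= b -> #|Bty| <= b -> k <= b -> t <= b -> #|A| + k = m + t -> j.+2 * m <= #|V| ->
  H \subset B -> #|H| + k' = k ->
  {in H, forall x, 16 * j.+2 * u <= #|[set y in B | G x y]|} ->
  (forall i, i <= j -> [/\ C i \subset B :\: (H :|: Bty), #|C i| <= 2 * u & expands h (C i) u]) ->
  disjoint_upto C j.+1 ->
  cycle_family r j.+2 cs0 -> size cs0 = k' ->
  {in flatten cs0, forall x, x \in B :\: H /\ forall i, i <= j -> x \notin C i} ->
  exists cs, cycle_family r j.+2 cs /\ size cs = m.
Proof.
move=> hC rC GC hr Gr j0 u0 hd dAB AB bu degA degB cA cB cAty cBty kb tb akm jm HB Hk degH HC dC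
  ccs0 scs0 mcs0.
set l := j.+2 in bu degA degB cA cB jm degH ccs0 *.
have l2 : 2 < l by [].
have BA x : x \in B -> x \in A -> False.
  by move=> xB xA; move/disjointFr: dAB => /(_ x xA); rewrite xB.
have AtyA : Aty \subset A by apply/subsetP=> x; rewrite inE => /andP[].
pose core := \bigcup_(i < j.+1) C i.
have coreP x : reflect (exists2 i, i <= j & x \in C i) (x \in core).
  apply: (iffP bigcupP) => [[i _ xi]|[i ij xi]]; first by exists i => //; rewrite -ltnS.
  by exists (Ordinal (ij : i < j.+1)).
have coreB : core \subset B.
  apply/subsetP=> x /coreP[i ij xi]; have [/subsetP/(_ x xi) + _ _] := HC i ij.
  by rewrite inE => /andP[].
have ccore : #|core| <= j.+1 * (2 * u).
  rewrite -[j.+1 in X in _ <= X]card_ord -sum_nat_const /core.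
  apply: (@leq_trans (\sum_(i < j.+1) #|C i|)).
    apply: (big_ind2 (fun (X : {set V}) n => #|X| <= n)); rewrite ?cards0 //.
    by move=> X n Y n' hX hY; rewrite cardsU; lia.
  by apply: leq_sum => i _; have [] := HC i (ltn_ord i).
pose F0 := [set x in flatten cs0].
have cF0 : #|F0| = l * k' by rewrite /F0 (card_flatten ccs0) scs0.
have k'b : k' <= b by lia.
have lb1 : l * k' <= l * b by rewrite leq_mul2l k'b orbT.
have cHA : #|H :|: Aty| = #|H| + #|Aty|.
  rewrite cardsU (_ : H :&: Aty = set0) ?cards0 ?subn0 //.
  by apply/setP=> x; rewrite !inE; apply/negP=> /and3P[/(subsetP HB) xB xA _]; apply: (BA x).
have cHA2 : #|H :|: Aty| <= 2 * b by lia.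
(* The greedy cycles avoid the cores reserved for the last step, the cycles [cs0], and all hubs; the
   hubs include the atypical vertices of [A]. *)
pose Z := core :|: F0 :|: (H :|: Aty).
have cZ : #|Z| <= j.+1 * (2 * u) + l * b + 2 * b.
  have := cardsU (core :|: F0) (H :|: Aty); have := cardsU core F0.
  by rewrite -/Z cF0; lia.
have degHA : {in H :|: Aty, forall x, 16 * l * u <= #|[set y in B | G x y]|}.
  by move=> x; rewrite inE => /orP[/degH//|/(subsetP AtyA)/degA].
have lhs : l * #|H :|: Aty| <= l * (2 * b) by rewrite leq_mul2l cHA2 orbT.
have [|||cs1 [ccs1 scs1 hcs1 mcs1 nA1]] := @hub_cycles V h r B Z u l (enum (H :|: Aty)) hC rC hr u0 hd isT.
- exact: enum_uniq.
- by move=> x; rewrite mem_enum => xH; rewrite inE xH orbT.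
- move=> x; rewrite mem_enum => /degHA dx; rewrite -cardE.
  have : [set y in B | G x y] \subset [set y in B | r x y].
    by apply/subsetP=> y; rewrite !inE => /andP[-> /Gr].
  move/subset_leq_card => dx'.
  have := cardsID Z [set y in B | r x y]; have := subset_leq_card (subsetIr [set y in B | r x y] Z).
  move: dx dx' cZ bu lhs; rewrite /l /=; clear; lia.
pose F1 := [set x in flatten cs1].
have cF1 : #|F1| = l * #|H :|: Aty| by rewrite /F1 (card_flatten ccs1) scs1 cardE.
have F1A x : x \in F1 -> x \in A -> x \in Aty.
  rewrite inE => /mcs1[]; rewrite ?mem_enum inE.
    by case/orP=> // /(subsetP HB) /BA/[apply].
  by case/andP=> _ /BA/[apply].
(* Two typical vertices of [A] have all but at most [2 * b] vertices of [B] as common neighbours, so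
   the two-vertex cycles use [A0], with everything occupied or reserved removed from [B]. *)
pose A0 := A :\: Aty; pose B0 := B :\: (core :|: F0 :|: F1).
have dA0B0 : [disjoint A0 & B0].
  by apply: disjointWl (subsetDl _ _) (disjointWr (subsetDl _ _) dAB).
have missA a : a \in A :\: Aty -> #|[set w in B | ~~ G a w]| <= b.
  rewrite !inE => /andP[+ aA]; rewrite aA /= -leqNgt.
  have := cardsID [set w in B | G a w] B.
  rewrite (_ : B :&: _ = [set w in B | G a w]); last first.
    by apply/setP=> w; rewrite !inE; case: (w \in B).
  rewrite (_ : B :\: _ = [set w in B | ~~ G a w]); first by clear; lia.
  by apply/setP=> w; rewrite !inE; case: (w \in B); rewrite ?andbF ?andbT.
have missB a : a \in B :\: Bty -> #|[set w in A | ~~ G a w]| <= b.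
  rewrite !inE => /andP[+ aB]; rewrite aB /= -leqNgt.
  have := cardsID [set w in A | G a w] A.
  rewrite (_ : A :&: _ = [set w in A | G a w]); last first.
    by apply/setP=> w; rewrite !inE; case: (w \in A).
  rewrite (_ : A :\: _ = [set w in A | ~~ G a w]); first by clear; lia.
  by apply/setP=> w; rewrite !inE; case: (w \in A); rewrite ?andbF ?andbT.
have lt : l * t <= l * b by rewrite leq_mul2l tb orbT.
have [||cs2 [ccs2 scs2 mcs2 nA2]] := @two_vertex_cycles V h r A0 B0 u l t hC rC hr u0 hd l2 dA0B0.
- have := cardsID Aty A; rewrite (setIidPr AtyA) -/A0.
  move: cA bu cAty lt; rewrite /l ?subSS ?subn0; clear; lia.
- move=> a a' aA a'A.
  have : B \subset [set w in B0 | r a w && r a' w] :|: (([set w in B | ~~ G a w] :|: [set w in B | ~~ G a' w])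
       :|: (core :|: F0 :|: F1)).
    apply/subsetP=> w wB; rewrite [w \in _ :|: _]inE orbC -implyNb; apply/implyP.
    rewrite !inE !negb_or wB /= !negbK => /and3P[/andP[/Gr-> /Gr->] -> ->]; by [].
  move/subset_leq_card.
  have := cardsU [set w in B0 | r a w && r a' w] (([set w in B | ~~ G a w] :|: [set w in B | ~~ G a' w])
       :|: (core :|: F0 :|: F1)).
  have := cardsU ([set w in B | ~~ G a w] :|: [set w in B | ~~ G a' w]) (core :|: F0 :|: F1).
  have := cardsU [set w in B | ~~ G a w] [set w in B | ~~ G a' w].
  have := cardsU (core :|: F0) F1; have := cardsU core F0.
  have := missA a aA; have := missA a' a'A.
  move: cB bu ccore cF0 cF1 lb1 lhs lt; rewrite /l ?subSS ?subn0; clear; lia.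
have ccs12 : cycle_family r l (cs1 ++ cs2).
  apply: cycle_family_cat => // x x1 /mcs2; rewrite !inE => /orP[/andP[xn xA]|].
    by case/negP: xn; move: (F1A x); rewrite !inE => -> //.
  by rewrite x1 orbT.
have ccs012 : cycle_family r l (cs0 ++ (cs1 ++ cs2)).
  apply: cycle_family_cat => // x x0; rewrite flatten_cat mem_cat => /orP[/mcs1[]|/mcs2].
  - rewrite mem_enum inE => /orP[xH|/(subsetP AtyA) xA].
      by have [] := mcs0 x x0; rewrite inE xH.
    by have [+ _] := mcs0 x x0; rewrite inE => /andP[_ /BA/(_ xA)].
  - by rewrite !inE x0 orbT.
  - rewrite !inE x0 !orbT /= orbF => /andP[_ xA].
    by have [+ _] := mcs0 x x0; rewrite inE => /andP[_ /BA/(_ xA)].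
pose F := [set x in flatten (cs0 ++ (cs1 ++ cs2))].
have cF : #|F| = l * (k' + (#|H| + #|Aty| + t)).
  by rewrite /F (card_flatten ccs012) !size_cat scs0 scs1 scs2 -cardE cHA.
(* The cycles [cs0] and those of [H] avoid [A], each atypical vertex accounts for one vertex of [A],
   and each two-vertex cycle for two. *)
have FA : #|A :&: F| = #|Aty| + 2 * t.
  rewrite /F (card_flattenI A ccs012) !flatten_cat !count_cat.
  have -> : count (mem A) (flatten cs0) = 0.
    apply/eqP; rewrite -leqn0 leqNgt -has_count; apply/hasPn=> x /mcs0[].
    by rewrite inE => /andP[_ /BA xA] _; apply/negP.
  rewrite nA1 //.
  have -> : count (mem A) (enum (H :|: Aty)) = #|Aty|.
    rewrite -size_filter -(card_uniqP (filter_uniq _ (enum_uniq _))).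
    apply: eq_card => x; rewrite mem_filter mem_enum in_setU /=.
    apply/idP/idP => [/andP[xA /orP[/(subsetP HB)/BA/(_ xA)|]] //|xA].
    by rewrite (subsetP AtyA) // xA orbT.
  suff <- : count (mem A0) (flatten cs2) = count (mem A) (flatten cs2) by rewrite nA2.
  apply: eq_in_count => x /mcs2; rewrite !inE => /orP[/andP[-> ->]//|].
  by case/andP=> _ xB; rewrite [x \in A](negbTE _) ?andbF //; apply/negP=> /(BA x xB).
have AtyF x : x \in Aty -> x \in F.
  move=> xA; rewrite inE flatten_cat mem_cat flatten_cat mem_cat hcs1 ?orbT //.
  by rewrite mem_enum inE xA orbT.
have cABV : #|A| + #|B| = #|V|.
  by rewrite -cardsT -AB cardsU (disjoint_setI0 dAB) cards0 subn0.
have cBF : #|B :&: F| + (#|Aty| + 2 * t) = #|F|.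
  rewrite -FA -(cardsID A F) [F :&: A]setIC addnC; congr (_ + #|pred_of_set _|).
  apply/setP=> x; have := in_setT x; rewrite -AB !inE.
  by case: (boolP (x \in A)) => [xA _|_ /= ->//]; apply/negP=> /andP[/BA/(_ xA)].
pose A' := A :\: F; pose W := B :\: F.
have cA' : #|A'| + (#|Aty| + 2 * t) = #|A| by have := cardsID F A; rewrite FA -/A'; clear; lia.
have cW : #|W| + #|B :&: F| = #|B| by have := cardsID F B; rewrite -/W; clear; lia.
have A'B : A' \subset A by apply: subsetDl.
have WB : W \subset B by apply: subsetDl.
have A'ty : A' \subset A :\: Aty.
  apply/subsetP=> x; rewrite inE => /andP[xF xA]; rewrite inE xA andbT.
  by apply: contra xF; apply: AtyF.
have CF i x : i <= j -> x \in C i -> x \notin F.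
  move=> ij xi; have xc : x \in core by apply/coreP; exists i.
  have xB := subsetP coreB x xc.
  rewrite inE !flatten_cat !mem_cat; apply/or3P=> -[/mcs0[_ /(_ i ij)]|/mcs1|/mcs2].
  - by rewrite xi.
  - rewrite mem_enum inE => -[/orP[xH|/(subsetP AtyA)/(BA x xB)//]|].
      by have [/subsetP/(_ x xi) + _ _] := HC i ij; rewrite !inE xH.
    by rewrite !inE xc.
  - by rewrite !inE xc /= orbF => /andP[_ /(BA x xB)].
have [||||||||||cs3 [ccs3 scs3 mcs3]] := @absorbing_cycles V h G r A' W Bty C j u b hC rC GC hr Gr j0.
- exact: disjointWl A'B (disjointWr WB dAB).
- exact: hd.
- move=> i ij; have [CB cC eC] := HC i ij; split=> //.
  apply/subsetP=> x xi; have := subsetP CB x xi; rewrite !in_setD in_setU negb_or.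
  by case/andP=> /andP[_ ->] ->; rewrite (CF i).
- exact: dC.
- exact: cBty.
- by move: cA cA' cAty tb bu; rewrite /l ?subSS ?subn0; clear; lia.
(* The sets [A'], [W] and [F] partition the vertices, and [l * #|A'| + #|F| = l * m <= #|V|]; hence
   [W] has room for [j + 1] classes of size [#|A'|]. *)
- have dist1 (c x y z : nat) : c * (x + (y + 2 * z)) = c * x + c * y + 2 * (c * z) by clear; lia.
  have dist2 (c x y z w : nat) : c * (x + (y + z + w)) = c * (y + x) + c * z + c * w by clear; lia.
  have E : l * #|A| = l * #|A'| + l * #|Aty| + 2 * (l * t) by rewrite -dist1 cA'.
  have E3 : #|F| = l * k + l * #|Aty| + l * t by rewrite cF -Hk dist2.
  have E4 : l * #|A| + l * k = l * m + l * t by rewrite -!mulnDr akm.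
  have E5 : j.+1 * #|A'| + #|A'| = l * #|A'| by rewrite /l; clear; lia.
  move: E E3 E4 E5 cA' cW cBF cABV jm; clear; lia.
- move=> a /(subsetP A'ty)/missA; apply: leq_trans.
  by apply/subset_leq_card/subsetP=> x; rewrite !inE => /andP[/andP[_ ->]].
- move=> w; rewrite !in_setD => /and3P[wT _ wB].
  apply: leq_trans (missB w _); last by rewrite in_setD wT.
  by apply/subset_leq_card/subsetP=> x; rewrite !in_set => /andP[/andP[_ ->]].
- move=> w /(subsetP WB)/degB; have := cardsID F [set y in A | G w y].
  have -> : [set y in A | G w y] :\: F = [set y in A' | G w y].
    by apply/setP=> y; rewrite !in_set; case: (y \in A); rewrite ?andbF ?andbT.
  have : #|[set y in A | G w y] :&: F| <= #|A :&: F|.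
    by apply/subset_leq_card/subsetP=> y; rewrite !in_set => /andP[/andP[->]].
  rewrite FA; move: u0 cAty tb bu; rewrite /l ?subSS ?subn0; clear; lia.
exists ((cs0 ++ (cs1 ++ cs2)) ++ cs3); split.
  apply: cycle_family_cat => // x xF /mcs3; rewrite !in_set -/(F) => /orP[]/andP[/negP]; by [].
(* The total is [k + #|Aty| + t + #|A'|] with [#|A'| = #|A| - #|Aty| - 2 * t], that is
   [#|A| + k - t = m]. *)
by rewrite !size_cat scs0 scs1 scs2 scs3 -cardE cHA; move: akm Hk cA'; clear; lia.
Qed.

Import Order.TTheory GRing.Theory Num.Theory.

(** * Random subsets *)

Section RandomSubsets.
Local Open Scope ring_scope.

(** The probability that a random subset of [P], with independent elements of density [p], equals
    [H]. The ground set [P] is a parameter so that it can be split into independent parts. *)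
Definition weight (R : nzRingType) (E : finType) (P : {set E}) (p : R) (H : {set E}) : R :=
  p ^+ #|H| * (1 - p) ^+ (#|P| - #|H|).

Definition prob (R : nzRingType) (E : finType) (P : {set E}) (p : R) (F : pred {set E}) : R :=
  \sum_(H : {set E} | (H \subset P) && F H) weight P p H.

(** Expand a product over all of [E] whose factors outside [P] are [0 + 1]: the terms with [H] not
    inside [P] vanish. *)
Lemma sum_subset_expr (R : comNzRingType) (E : finType) (P : {set E}) (x y : R) :
  \sum_(H : {set E} | H \subset P) x ^+ #|H| * y ^+ (#|P| - #|H|) = (x + y) ^+ #|P|.
Proof.
have -> : (x + y) ^+ #|P| =
    \prod_(i : E) ((if i \in P then x else 0) + (if i \in P then y else 1)).
  rewrite -prodr_const [RHS](bigID (mem P)) /= [X in _ * X]big1 ?mulr1.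
    by apply: eq_bigr => i ->.
  by move=> i /negbTE->; rewrite add0r.
rewrite bigA_distr [RHS](bigID (fun H : {set E} => H \subset P)) /= [X in _ = _ + X]big1 ?addr0.
  apply: eq_bigr => H HP; rewrite (bigID (mem H)) /=; congr (_ * _).
    by rewrite -prodr_const; apply: eq_bigr => i iH; rewrite iH (subsetP HP).
  have -> : (#|P| - #|H|)%N = #|P :\: H|.
    by have := cardsID H P; rewrite (setIidPr HP); lia.
  rewrite -prodr_const [LHS]big_mkcond [LHS](bigID (mem H)) /= [X in X * _ = _]big1 ?mul1r.
    by apply: eq_bigr => i /negbTE iH; rewrite inE iH.
  by move=> i iH; rewrite inE iH.
move=> H /subsetPn[i iH iP]; rewrite (bigD1 i) //= iH (negbTE iP) mul0r //.
Qed.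

Lemma sum_expr_card (R : comNzRingType) (E : finType) (z : R) :
  \sum_(S : {set E}) z ^+ #|S| = (1 + z) ^+ #|E|.
Proof.
rewrite addrC -cardsT -sum_subset_expr; apply: eq_big => [S|S _]; first by rewrite subsetT.
by rewrite expr1n mulr1.
Qed.

Lemma weight_total (R : comNzRingType) (E : finType) (P : {set E}) (p : R) :
  \sum_(H : {set E} | H \subset P) weight P p H = 1.
Proof. by rewrite sum_subset_expr addrC subrK expr1n. Qed.

(** Independence of the traces of the random set on [P2] and on its complement, as an iterated
    sum. *)
Lemma weight_split (R : comNzRingType) (E : finType) (P P2 : {set E}) (p : R) (F : {set E} -> R) :
  P2 \subset P ->
  \sum_(H : {set E} | H \subset P) weight P p H * F H =
  \sum_(H1 : {set E} | H1 \subset P :\: P2) weight (P :\: P2) p H1 *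
    (\sum_(H2 : {set E} | H2 \subset P2) weight P2 p H2 * F (H1 :|: H2)).
Proof.
move=> PP.
under [RHS]eq_bigr do rewrite mulr_sumr.
rewrite pair_big_dep /=.
rewrite (reindex_onto (fun q : {set E} * {set E} => q.1 :|: q.2)
  (fun H => (H :\: P2, H :&: P2))) /=; last by move=> H _; rewrite setUC setID.
apply: eq_big => [[H1 H2]|[H1 H2] /=].
  rewrite /= xpair_eqE subUset; apply/andP/andP=> [[/andP[H1P H2P] /andP[/eqP E1 /eqP E2]]|[H1P H2P]].
    split; last by rewrite -E2 subsetIr.
    by rewrite -E1 setSD // subUset H1P.
  have d1 : H1 :&: P2 = set0.
    by apply/eqP; rewrite setI_eq0; move: H1P; rewrite subsetD => /andP[].
  have D1 : H1 :\: P2 = H1 by move: H1P; rewrite subsetD => /andP[_ /setDidPl].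
  rewrite (subset_trans H1P (subsetDl _ _)) (subset_trans H2P PP); split=> //.
  rewrite setDUl D1 (_ : H2 :\: P2 = set0) ?setU0 ?eqxx /=.
    by rewrite setIUl d1 set0U; apply/eqP/setIidPl.
  by apply/eqP; rewrite setD_eq0.
case/andP=> HP; rewrite xpair_eqE => /andP[/eqP E1 /eqP E2].
rewrite mulrA; congr (_ * _); rewrite /weight.
have c1 : #|H1 :|: H2| = (#|H1| + #|H2|)%N.
  rewrite cardsU (_ : H1 :&: H2 = set0) ?cards0 ?subn0 //.
  by rewrite -E1 -E2; apply/setP=> x; rewrite !inE; case: (x \in P2); rewrite ?andbF.
have h1 : (#|H1| <= #|P :\: P2|)%N by rewrite -E1 subset_leq_card // setSD.
have h2 : (#|H2| <= #|P2|)%N by rewrite -E2 subset_leq_card // subsetIr.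
have cP : #|P| = (#|P :\: P2| + #|P2|)%N.
  by have := cardsID P2 P; rewrite (setIidPr PP); lia.
rewrite c1 (_ : (#|P| - _ = (#|P :\: P2| - #|H1|) + (#|P2| - #|H2|))%N); last by lia.
by rewrite !exprD mulrACA.
Qed.

(** The target [T] depends only on the part outside [P2]. Once that part is exposed, [T] is a fixed
    subset of [P2] of at least [t] elements, all still random. *)
Lemma prob_condition (R : numDomainType) (E : finType) (P P2 : {set E}) (p : R)
    (T : {set E} -> {set E}) (good : pred {set E}) (t : nat) :
  0 <= p <= 1 -> P2 \subset P ->
  (forall H1 : {set E}, H1 \subset P :\: P2 -> good H1 -> T H1 \subset P2 /\ (t <= #|T H1|)%N) ->
  prob P p (fun H => good (H :\: P2) && (H :&: T (H :\: P2) == set0)) <= (1 - p) ^+ t.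
Proof.
move=> /andP[p0 p1] PP HT; have q0 : 0 <= 1 - p by rewrite subr_ge0.
have q1 : 1 - p <= 1 by rewrite gerBl.
have w0 (S H : {set E}) : 0 <= weight S p H by rewrite mulr_ge0 ?exprn_ge0.
pose F H : R := (good (H :\: P2) && (H :&: T (H :\: P2) == set0))%:R.
have -> : prob P p (fun H => good (H :\: P2) && (H :&: T (H :\: P2) == set0)) =
    \sum_(H : {set E} | H \subset P) weight P p H * F H.
  rewrite /prob big_mkcondr /=; apply: eq_bigr => H _; rewrite /F.
  by case: ifP => _; rewrite ?mulr1 ?mulr0.
rewrite (weight_split p F PP) -[leRHS]mul1r -[X in _ <= X * _](weight_total (P :\: P2) p) mulr_suml.
apply: ler_sum => H1 H1P; apply: ler_wpM2l => //.
have H1P2 : H1 :&: P2 = set0.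
  by apply/eqP; rewrite setI_eq0; move: H1P; rewrite subsetD => /andP[].
have E1 (H2 : {set E}) : H2 \subset P2 -> (H1 :|: H2) :\: P2 = H1.
  move=> H2P; rewrite setDUl (_ : H2 :\: P2 = set0) ?setU0; last by apply/eqP; rewrite setD_eq0.
  by move: H1P; rewrite subsetD => /andP[_ /setDidPl].
case: (boolP (good H1)) => [gH1|bH1]; last first.
  rewrite big1 ?exprn_ge0 // => H2 H2P; by rewrite /F E1 // (negbTE bH1) mulr0.
have [TP tT] := HT H1 H1P gH1.
have T1 : H1 :&: T H1 = set0.
  by apply/eqP; rewrite -subset0 -H1P2 setIS.
have H2T (H2 : {set E}) : H2 \subset P2 -> F (H1 :|: H2) = (H2 :&: T H1 == set0)%:R.
  by move=> H2P; rewrite /F E1 // gH1 /= setIUl T1 set0U.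
apply: (@le_trans _ _ ((1 - p) ^+ #|T H1|)); last by rewrite ler_wiXn2l.
(* After splitting [P2] along [T H1], only the empty subset of [T H1] contributes. *)
rewrite (weight_split p _ TP) (eq_bigr (fun H2 => weight (P2 :\: T H1) p H2 * (1 - p) ^+ #|T H1|)).
  by rewrite -mulr_suml weight_total mul1r.
move=> H2 H2P; congr (_ * _).
have H2P2 : H2 \subset P2 by apply: subset_trans H2P (subsetDl _ _).
have d2 : H2 :&: T H1 = set0.
  by apply/eqP; rewrite setI_eq0; move: H2P; rewrite subsetD => /andP[].
rewrite (bigD1 set0) ?sub0set //= big1 ?addr0.
  by rewrite setU0 H2T // d2 eqxx mulr1 /weight cards0 expr0 mul1r subn0.
move=> H3 /andP[H3T H30]; rewrite H2T; last by rewrite subUset H2P2 (subset_trans H3T TP).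
by rewrite setIUl d2 set0U (setIidPl H3T) (negbTE H30) mulr0.
Qed.

Lemma prob_avoid (R : numDomainType) (E : finType) (P T : {set E}) (p : R) :
  0 <= p <= 1 -> T \subset P ->
  prob P p (fun H => H :&: T == set0) <= (1 - p) ^+ #|T|.
Proof.
move=> p01 TP; apply: le_trans (prob_condition (T := fun=> T) (good := xpredT) p01 TP _) => //.
Qed.

Lemma prob_union (R : numDomainType) (E : finType) (P : {set E}) (p : R)
    (F F1 F2 : pred {set E}) :
  0 <= p <= 1 -> (forall H : {set E}, H \subset P -> F H -> F1 H || F2 H) ->
  prob P p F <= prob P p F1 + prob P p F2.
Proof.
move=> /andP[p0 p1] HF; rewrite /prob !big_mkcondr /= -big_split /=.
apply: ler_sum => H HP; have w0 : 0 <= weight P p H by rewrite mulr_ge0 ?exprn_ge0 ?subr_ge0.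
by have := HF H HP; do 3!case: ifP => //= _; rewrite ?addr0 ?add0r ?addr_ge0 // ?lerDl // => /(_ isT).
Qed.

Lemma prob_exists (R : numDomainType) (E I : finType) (P : {set E}) (p : R)
    (F : pred {set E}) (A : pred I) (B : I -> pred {set E}) :
  0 <= p <= 1 -> (forall H : {set E}, H \subset P -> F H -> exists2 i, A i & B i H) ->
  prob P p F <= \sum_(i | A i) prob P p (B i).
Proof.
move=> /andP[p0 p1] HF; rewrite /prob big_mkcondr /=.
under [leRHS]eq_bigr do rewrite big_mkcondr /=.
rewrite exchange_big /=; apply: ler_sum => H HP.
have w0 : 0 <= weight P p H by rewrite mulr_ge0 ?exprn_ge0 ?subr_ge0.
have w1 i : 0 <= (if B i H then weight P p H else 0) by case: ifP.
case: ifP => [/(HF H HP)[i Ai Bi]|_]; last exact: sumr_ge0.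
by rewrite (bigD1 i) //= Bi lerDl sumr_ge0.
Qed.

Lemma sum_pairs_expr (R : comNzRingType) (V : finType) (z : R) :
  \sum_(q : {set V} * {set V} | q.1 != set0) z ^+ (#|q.1| + #|q.2|) =
  ((1 + z) ^+ #|V| - 1) * (1 + z) ^+ #|V|.
Proof.
transitivity (\sum_(S : {set V} | S != set0) \sum_(Q : {set V}) z ^+ (#|S| + #|Q|)).
  by rewrite pair_big_dep; apply: eq_bigl => q; rewrite andbT.
under eq_bigr do under eq_bigr do rewrite exprD.
under eq_bigr do rewrite -mulr_sumr sum_expr_card.
rewrite -mulr_suml -(sum_expr_card V z) [X in (X - 1)](bigD1 set0) //= cards0 expr0.
by rewrite addrC addrK.
Qed.

(** Union bound over pairs of vertex sets. As the first set is nonempty, the bound carries the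
    factor [(1 + z) ^+ #|V| - 1], which is small once [z] is far below [1 / #|V|]. *)
Lemma prob_pairs_avoid (R : numDomainType) (E V : finType) (P : {set E}) (p z : R)
    (F : pred {set E}) (A : pred ({set V} * {set V})) (T : {set V} * {set V} -> {set E}) :
  0 <= p <= 1 -> 0 <= z ->
  (forall H : {set E}, H \subset P -> F H -> exists2 q, A q & H :&: T q == set0) ->
  (forall q, A q -> [/\ q.1 != set0, T q \subset P &
    (1 - p) ^+ #|T q| <= z ^+ (#|q.1| + #|q.2|)]) ->
  prob P p F <= ((1 + z) ^+ #|V| - 1) * (1 + z) ^+ #|V|.
Proof.
move=> p01 z0 HF HA; apply: le_trans (prob_exists p01 HF) _.
rewrite -sum_pairs_expr.
apply: (@le_trans _ _ (\sum_(q | A q) z ^+ (#|q.1| + #|q.2|))).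
  by apply: ler_sum => q /HA[_ TP]; apply: le_trans; apply: prob_avoid.
rewrite [leRHS]big_mkcond [leLHS]big_mkcond; apply: ler_sum => q _.
by case: ifP => [/HA[-> _ _]//|_]; case: ifP => // _; rewrite exprn_ge0.
Qed.

End RandomSubsets.

(** * Random edges between fixed vertex sets *)

Definition edge_rel (V : finType) (H : {set {set V}}) : rel V := fun x y => [set x; y] \in H.

Definition edges_of (V : finType) (X : {set V * V}) : {set {set V}} :=
  [set [set q.1; q.2] | q in X].

Lemma edge_rel_sym (V : finType) (H : {set {set V}}) : symmetric (edge_rel H).
Proof. by move=> x y; rewrite /edge_rel setUC. Qed.

Lemma set2_inj_disjoint (V : finType) (S T : {set V}) x y x' y' : [disjoint S & T] ->
  x \in S -> y \in T -> x' \in S -> y' \in T -> [set x; y] = [set x'; y'] -> x = x' /\ y = y'.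
Proof.
move=> dST xS yT x'S y'T E.
have ne s t : s \in S -> t \in T -> s == t = false.
  by move=> sS tT; apply/eqP=> st; move/disjointFr: dST => /(_ s sS); rewrite st tT.
have := set21 x y; rewrite E !inE (ne x y') // orbF => /eqP ->; split=> //.
by have := set22 x y; rewrite E !inE [y == x']eq_sym (ne x' y) //= => /eqP.
Qed.

(** Between disjoint sets an unordered edge determines its ordered pair, so nothing is lost in
    passing to edges. *)
Lemma card_edges_of (V : finType) (S T : {set V}) (X : {set V * V}) : [disjoint S & T] ->
  X \subset setX S T -> #|edges_of X| = #|X|.
Proof.
move=> dST XST; apply: card_in_imset => -[x y] [x' y'] /(subsetP XST) + /(subsetP XST).
rewrite !inE /= => /andP[xS yT] /andP[x'S y'T] E.
by have [-> ->] := set2_inj_disjoint dST xS yT x'S y'T E.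
Qed.

Lemma edges_of_pairs (V : finType) (S T : {set V}) (X : {set V * V}) : [disjoint S & T] ->
  X \subset setX S T -> edges_of X \subset [set e : {set V} | #|e| == 2].
Proof.
move=> dST XST; apply/subsetP=> _ /imsetP[[x y] /(subsetP XST) + ->].
rewrite !inE /= => /andP[xS yT]; rewrite cards2 (_ : x != y) //.
by apply/eqP=> xy; move/disjointFr: dST => /(_ x xS); rewrite xy yT.
Qed.

Lemma edges_of_meet (V : finType) (H : {set {set V}}) (X : {set V * V}) :
  H :&: edges_of X != set0 -> exists2 q, q \in X & edge_rel H q.1 q.2.
Proof.
by case/set0Pn=> e; rewrite inE => /andP[eH /imsetP[q qX E]]; exists q; rewrite // /edge_rel -E.
Qed.

(** The common shape of the bad events: some admissible index has none of its target pairs as a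
    random edge. *)
Definition some_missed (V I : finType) (A : pred I) (T : I -> {set V * V}) : pred {set {set V}} :=
  fun H => [exists i, A i && (H :&: edges_of (T i) == set0)].

Lemma some_missedPn (V I : finType) (A : pred I) (T : I -> {set V * V}) H i :
  ~~ some_missed A T H -> A i -> exists2 q, q \in T i & edge_rel H q.1 q.2.
Proof.
rewrite negb_exists => /forallP/(_ i); rewrite negb_and => /orP[/negP//|ne _].
exact: edges_of_meet.
Qed.

(** Sizes are exactly [u], which is enough for [joins_large] since larger sets contain such
    subsets. *)
Definition sparse_pair (V : finType) (u : nat) : pred ({set V} * {set V}) :=
  fun q => [&& [disjoint q.1 & q.2], #|q.1| == u & #|q.2| == u].

Lemma joins_large_edge_rel (V : finType) u (H : {set {set V}}) :
  ~~ some_missed (sparse_pair u) (fun q => setX q.1 q.2) H -> joins_large (edge_rel H) u.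
Proof.
move=> HH X Y dXY uX uY; have [X' cX XX] := subset_of_card uX; have [Y' cY YY] := subset_of_card uY.
have [|[x y]] := some_missedPn (i := (X', Y')) HH.
  by rewrite /sparse_pair /= cX cY !eqxx (disjointWl XX (disjointWr YY dXY)).
rewrite inE /= => /andP[xX yY] xy; exists x, y.
by split=> //; [apply: (subsetP XX) | apply: (subsetP YY)].
Qed.

(* [q.2] stands for the neighbours of [q.1] in [W]: no edge joins [q.1] to the rest of [W]. *)
Definition narrow_pair (V : finType) (W : {set V}) (e : nat) : pred ({set V} * {set V}) :=
  fun q => [&& q.1 != set0, [disjoint q.1 & W], #|q.1| <= e & #|q.2| < #|q.1|].

Lemma expands_edge_rel (V : finType) (W : {set V}) e (H : {set {set V}}) :
  ~~ some_missed (narrow_pair W e) (fun q => setX q.1 (W :\: q.2)) H -> expands (edge_rel H) W e.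
Proof.
move=> HH S dSW Se; rewrite leqNgt; apply/negP=> lt.
have [|[x y]] := some_missedPn (i := (S, nbrs (edge_rel H) S W)) HH.
  by rewrite /narrow_pair /= dSW Se lt -card_gt0; lia.
rewrite !inE /= => /andP[xS /andP[+ yW]] xy; rewrite yW /= => /exists_inP[].
by exists x.
Qed.

Section Probability.
Local Open Scope ring_scope.

(** There are [u * u] pairs to miss, so the hypothesis on [z] gives [z ^+ (2 * u)], exactly the
    weight of two sets of size [u]. *)
Lemma prob_sparse_pair (R : numDomainType) (V : finType) (p z : R) u :
  0 <= p <= 1 -> 0 <= z -> (0 < u)%N -> (1 - p) ^+ u <= z ^+ 2 ->
  prob [set e : {set V} | #|e| == 2%N] p (some_missed (sparse_pair u) (fun q => setX q.1 q.2)) <=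
  ((1 + z) ^+ #|V| - 1) * (1 + z) ^+ #|V|.
Proof.
move=> p01 z0 u0 qz; have /andP[p0 p1] := p01; have q0 : 0 <= 1 - p by rewrite subr_ge0.
apply: (prob_pairs_avoid (A := @sparse_pair V u) (T := fun q => edges_of (setX q.1 q.2))) => //.
  by move=> H _ /existsP[q /andP[Aq Tq]]; exists q.
move=> [S T] /and3P[/= dST /eqP cS /eqP cT]; split.
- by rewrite -card_gt0 cS.
- exact: edges_of_pairs dST (subxx _).
- rewrite (card_edges_of dST) // cardsX cS cT exprM addnn -mul2n exprM.
  by apply: lerXn2r; rewrite ?nnegrE ?exprn_ge0.
Qed.

(** As [#|q.2| < #|q.1| <= e], at least [e] vertices of [W] remain, so at least [e * #|q.1|] pairs
    are missed. This costs [z ^+ (2 * #|q.1|)], which covers both sets. *)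
Lemma prob_narrow_pair (R : numDomainType) (V : finType) (W : {set V}) (p z : R) e :
  0 <= p <= 1 -> 0 <= z -> z <= 1 -> #|W| = (2 * e)%N -> (1 - p) ^+ e <= z ^+ 2 ->
  prob [set e : {set V} | #|e| == 2%N] p
    (some_missed (narrow_pair W e) (fun q => setX q.1 (W :\: q.2))) <=
  ((1 + z) ^+ #|V| - 1) * (1 + z) ^+ #|V|.
Proof.
move=> p01 z0 z1 cW qz; have /andP[p0 p1] := p01; have q0 : 0 <= 1 - p by rewrite subr_ge0.
have q1 : 1 - p <= 1 by rewrite gerBl.
apply: (prob_pairs_avoid (A := narrow_pair W e) (T := fun q => edges_of (setX q.1 (W :\: q.2)))) => //.
  by move=> H _ /existsP[q /andP[Aq Tq]]; exists q.
move=> [S Q] /and4P[/= S0 dSW cS cQ].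
have dSW' : [disjoint S & W :\: Q] by apply: disjointWr (subsetDl _ _) dSW.
split=> //; first exact: edges_of_pairs dSW' (subxx _).
rewrite (card_edges_of dSW') // cardsX.
have ceW : (e <= #|W :\: Q|)%N.
  have := cardsID Q W; have := subset_leq_card (subsetIr W Q).
  by move: cW cS cQ; clear; lia.
apply: (@le_trans _ _ ((1 - p) ^+ (e * #|S|))).
  by rewrite ler_wiXn2l // mulnC leq_mul2l ceW orbT.
rewrite exprM; apply: (@le_trans _ _ ((z ^+ 2) ^+ #|S|)).
  by apply: lerXn2r; rewrite ?nnegrE ?exprn_ge0.
by rewrite -exprM ler_wiXn2l //; move: cQ; clear; lia.
Qed.

End Probability.

(** * Random chains and the edges that close them *)

(** The first class may be small and needs only expansion into [D 1]. The later classes have equal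
    size and serve as their own cores in [robust_matching]. *)
Lemma random_chain (V : finType) (h : rel V) (D : nat -> {set V}) j u e :
  symmetric h -> joins_large h u -> u <= e -> disjoint_upto D j.+1 -> #|D 0| <= e ->
  (forall i, 0 < i <= j -> #|D i| = 2 * e /\ expands h (D i) e) -> exists f, chain h D j f.
Proof.
move=> hC hd ue dD D0 HD; apply: chain_exists => // i ij.
have dDi : [disjoint D i & D i.+1].
  rewrite -setI_eq0; apply/eqP/setP=> x; rewrite !inE; apply/andP=> -[x1 x2].
  by have := dD i i.+1 x; lia.
have [cD2 ex2] := HD i.+1 ij.
case: i ij dDi cD2 ex2 => [|i] ij dDi cD2 ex2.
  apply: hall => S SD; apply: ex2; first exact: disjointWl SD dDi.
  exact: leq_trans (subset_leq_card SD) D0.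
have [cD1 ex1] := HD i.+1 (ltnW ij).
apply: (robust_matching (X0 := D i.+1) (Y0 := D i.+2) (e := e)) => //; first by rewrite cD1.
by move=> X Y dXY eX eY; apply: hd => //; lia.
Qed.

Definition has_chain (V : finType) (h : rel V) (D : nat -> {set V}) j : bool :=
  `[< exists f, chain h D j f >].

(** A fixed choice, made a function of [h], so that the closing pairs are determined by the edges
    already exposed. The value [id] is a dummy for the case without a chain. *)
Definition the_chain (V : finType) (h : rel V) (D : nat -> {set V}) j : V -> V :=
  if pselect (exists f, chain h D j f) is left ex then projT1 (cid ex) else id.

Lemma the_chainP (V : finType) (h : rel V) (D : nat -> {set V}) j :
  has_chain h D j -> chain h D j (the_chain h D j).
Proof.
by move/asboolP=> ex; rewrite /the_chain; case: pselect => // ex'; apply: (projT2 (cid ex')).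
Qed.

(** With [e] sending the start of a path to its end, these are the pairs whose presence closes a
    cycle through an edge of [G] between [X] and [Y]. *)
Definition closing_pairs (V : finType) (G : rel V) (X Y : {set V}) (e : V -> V) : {set V * V} :=
  [set (e q.1, q.2) | q in [set q in setX X Y | G q.1 q.2]].

Lemma card_closing_pairs (V : finType) (G : rel V) (X Y : {set V}) e :
  {in X &, injective e} -> #|closing_pairs G X Y e| = edges G X Y.
Proof.
move=> ei; rewrite card_in_imset.
  rewrite /edges pair_big /= -sum1_card big_mkcond [RHS]big_mkcond /=.
  apply: eq_bigr => q _; rewrite !inE; case: ifP => [/andP[-> ->]//|].
  by case: ifP => //= _; case: (G _ _).
move=> [x y] [x' y']; rewrite !inE /= => /andP[/andP[xX _] _] /andP[/andP[x'X _] _] [E ->].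
by rewrite (ei x x').
Qed.

Section Closing.
Context (V : finType) (G : rel V) (D : nat -> {set V}) (Y : {set V}) (j k : nat).

Let last_pairs : {set {set V}} := edges_of (setX (D j) Y).

(* The chain depends only on the edges outside [last_pairs], hence is independent of those that
   close the cycles. *)
Definition unclosed : pred {set {set V}} := fun H =>
  let h := edge_rel (H :\: last_pairs) in
  has_chain h D j && [exists U : {set V}, (#|U| <= 2 * k) &&
    (H :&: edges_of (closing_pairs G (D 0 :\: U) (Y :\: U) (iter j (the_chain h D j))) == set0)].

Context (dYD : forall i, i <= j -> [disjoint Y & D i]).

Lemma closing_pairs_sub (X Y' : {set V}) h : X \subset D 0 -> Y' \subset Y -> has_chain h D j ->
  closing_pairs G X Y' (iter j (the_chain h D j)) \subset setX (D j) Y.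
Proof.
move=> XD YY /the_chainP Hf; have [H _] := chain_iter Hf (leqnn j).
apply/subsetP=> _ /imsetP[[x y] + ->]; rewrite !inE /= => /andP[/andP[xX yY] _].
by rewrite H ?(subsetP XD) // (subsetP YY).
Qed.

(** Edges of the chain stay inside the classes, whereas every last pair has an end in [Y]. *)
Lemma chain_avoids_last_pairs (H : {set {set V}}) f :
  chain (edge_rel H) D j f -> chain (edge_rel (H :\: last_pairs)) D j f.
Proof.
move=> Hf i ij; have [H1 H2] := Hf i ij; split=> // x xD; have [fx hx] := H1 x xD.
split=> //; rewrite /edge_rel inE [_ \in H]hx andbT; apply/negP=> /imsetP[[r y]].
rewrite inE /= => /andP[_ yY] E.
have := set22 r y; rewrite -E !inE => /orP[]/eqP E'; subst y.
  by move/disjointFr: (dYD (ltnW ij)) => /(_ _ yY); rewrite xD.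
by move/disjointFr: (dYD ij) => /(_ _ yY); rewrite fx.
Qed.

Lemma closed_cycles (H : {set {set V}}) (r : rel V) :
  symmetric G -> subrel (edge_rel H) r -> subrel G r -> disjoint_upto D j.+1 ->
  (exists f, chain (edge_rel H) D j f) -> ~~ unclosed H ->
  exists cs, [/\ cycle_family r j.+2 cs, size cs = k &
    {in flatten cs, forall x, x \in Y \/ exists2 i, i <= j & x \in D i}].
Proof.
move=> GC hr Gr dD [f0 Hf0].
have hc : has_chain (edge_rel (H :\: last_pairs)) D j.
  by apply/asboolP; exists f0; apply: chain_avoids_last_pairs.
rewrite /unclosed hc /= negb_exists => /forallP HU.
have Hf := the_chainP hc; set f := the_chain _ _ _ in Hf HU.
have Hf' : chain (edge_rel H) D j f.
  move=> i ij; have [H1 H2] := Hf i ij; split=> // x /H1[fx].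
  by rewrite /edge_rel inE => /andP[_ hx].
apply: (inner_cycles GC hr Gr dD Hf' dYD) => U cU.
have := HU U; rewrite cU /= => /edges_of_meet[q /imsetP[[x y]]].
by rewrite !in_set /= => /andP[/andP[xD yY] Gxy] -> /= hq; exists x, y; rewrite !in_setD.
Qed.

Local Open Scope ring_scope.

(** Union bound over the possible covers [U]. The exponent [(2 * k).+1] leaves [z * z ^+ #|U|] for
    each of them, which sums to at most the stated bound. *)
Lemma prob_unclosed (R : numDomainType) (p z : R) t :
  0 <= p <= 1 -> 0 <= z -> z <= 1 ->
  (forall U : {set V}, (#|U| <= 2 * k)%N -> (t <= edges G (D 0 :\: U) (Y :\: U))%N) ->
  (1 - p) ^+ t <= z ^+ (2 * k).+1 ->
  prob [set e : {set V} | #|e| == 2%N] p unclosed <= z * (1 + z) ^+ #|V|.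
Proof.
move=> p01 z0 z1 Ht qz.
have dDY : [disjoint D j & Y] by rewrite disjoint_sym dYD.
apply: le_trans (prob_exists (A := fun U : {set V} => (#|U| <= 2 * k)%N)
  (B := fun U H => has_chain (edge_rel (H :\: last_pairs)) D j &&
    (H :&: edges_of (closing_pairs G (D 0 :\: U) (Y :\: U)
       (iter j (the_chain (edge_rel (H :\: last_pairs)) D j))) == set0)) p01 _) _.
  by move=> H _ /andP[hc /existsP[U /andP[cU HU]]]; exists U; rewrite // hc.
apply: (@le_trans _ _ (\sum_(U : {set V} | (#|U| <= 2 * k)%N) z * z ^+ #|U|)); last first.
  rewrite -(sum_expr_card V z) mulr_sumr [leLHS]big_mkcond; apply: ler_sum => U _.
  by case: ifP => // _; rewrite mulr_ge0 ?exprn_ge0.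
apply: ler_sum => U cU; apply: (@le_trans _ _ ((1 - p) ^+ t)); last first.
  by apply: le_trans qz _; rewrite -exprS ler_wiXn2l.
apply: (prob_condition (P2 := last_pairs) (good := fun H1 => has_chain (edge_rel H1) D j)
  (T := fun H1 => edges_of (closing_pairs G (D 0 :\: U) (Y :\: U)
       (iter j (the_chain (edge_rel H1) D j))))) => //.
  exact: edges_of_pairs dDY (subxx _).
move=> H1 _ hc.
have sub : closing_pairs G (D 0 :\: U) (Y :\: U) (iter j (the_chain (edge_rel H1) D j)) \subset setX (D j) Y.
  by apply: closing_pairs_sub => //; apply: subsetDl.
split; first exact: imsetS.
rewrite (card_edges_of dDY sub) card_closing_pairs ?Ht // => x x' /setDP[xD _] /setDP[x'D _].
by have [_] := chain_iter (the_chainP hc) (leqnn j); apply.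
Qed.

End Closing.

(** * The probability that the required cycles exist *)

(** Over ordinals this is convertible to [union_graph]; any finite vertex type is allowed here. *)
Definition union_rel (V : finType) (G : rel V) (H : {set {set V}}) : rel V :=
  fun x y => (x != y) && (G x y || ([set x; y] \in H)).

Local Open Scope ring_scope.

Lemma prob_le_good (R : numDomainType) (E : finType) (P : {set E}) (p c : R)
    (good bad : pred {set E}) :
  0 <= p <= 1 -> (forall H : {set E}, H \subset P -> ~~ bad H -> good H) ->
  prob P p bad <= c -> 1 - c <= prob P p good.
Proof.
move=> p01 gb Hc; rewrite lerBlDr.
have -> : 1 = prob P p xpredT.
  by rewrite -(weight_total P p); apply: eq_bigl => H; rewrite andbT.
apply: le_trans (prob_union (F1 := good) (F2 := bad) p01 _) _; last by rewrite lerD2l.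
by move=> H HP _; case: (boolP (bad H)) => [|/(gb H HP)->]; rewrite ?orbT.
Qed.

(** All vertex sets are fixed from [G] alone before the random edges are examined; outside the bad
    events the deterministic assembly applies. *)
Lemma random_cycles (R : numDomainType) (V : finType) (G : rel V) (A : {set V}) (B := ~: A)
    j u b k t m (p z : R) (good : pred {set {set V}}) :
  symmetric G -> irreflexive G -> (0 < j)%N -> (0 < u)%N -> (20 * j.+2 * b <= u)%N ->
  {in A, forall x, (16 * j.+2 * u <= #|[set y in B | G x y]|)%N} ->
  {in B, forall x, (16 * j.+2 * u <= #|[set y in A | G x y]|)%N} ->
  {in B, forall x, (k <= #|[set y in B | G x y]|)%N} ->
  (48 * j.+2 * u <= #|A|)%N -> (16 * j.+2 * (512 * j.+2 * u) <= #|B|)%N ->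
  (#|[set x in A | (#|[set y in B | G x y]| + b < #|B|)%N]| <= b)%N ->
  (#|[set x in B | (#|[set y in A | G x y]| + b < #|A|)%N]| <= b)%N ->
  (k <= b)%N -> (t <= b)%N -> (#|A| + k = m + t)%N -> (j.+2 * m <= #|V|)%N ->
  0 <= p <= 1 -> 0 <= z -> z <= 1 -> (1 - p) ^+ u <= z ^+ 2 ->
  (forall H cs, cycle_family (union_rel G H) j.+2 cs -> size cs = m -> good H) ->
  1 - (((1 + z) ^+ #|V| - 1) * (1 + z) ^+ #|V| *+ (2 * j + 3) + z * (1 + z) ^+ #|V|) <=
  prob [set e : {set V} | #|e| == 2%N] p good.
Proof.
move=> GC GI j0 u0 bu degA degB degBB cA cB cAty cBty kb tb akm jm p01 z0 z1 qz Hgood.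
have /andP[p0 p1] := p01; have q0 : 0 <= 1 - p by rewrite subr_ge0.
have q1 : 1 - p <= 1 by rewrite gerBl.
have lt2 i : (i <= j)%N -> (i < 2 * j.+1)%N by clear; lia.
have lt2' i : (i <= j)%N -> (j.+1 + i < 2 * j.+1)%N by clear; lia.
set Bty := [set x in B | _] in cBty.
set l := j.+2 in bu degA degB cA cB jm *.
(* This makes [edges G X Y] at least [64 * l * u * k']. Deleting [2 * k'] vertices of degree at most
   [16 * l * u] leaves half of that, more than the [u * (2 * k').+1] needed for closing. *)
pose e := (512 * l * u)%N.
have ue : (u <= e)%N by rewrite leq_pmull.
have [||Hub [X [Y [Q [k' [[HB Hk degH] [XB YB QB] [dXY dXQ dYQ] [cX degX degY] [eXY cQ]]]]]]] :=
  @hub_or_sparse _ G B k e (16 * l * u) GC GI.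
- by move: cB kb bu; rewrite /e /l; clear; lia.
- exact: degBB.
(* The typical part of [Q] is cut into blocks: [P i] with [0 < i <= j] serves as the class [D i] of
   the inner cycles, and [P (j.+1 + i)] contains the core [C i]. Hence the inner cycles stay off the
   cores. *)
have [|||P HP dP] := @extend_disjoint_sets _ (fun=> set0) (2 * j.+1) (2 * e) (Q :\: Bty).
- by move=> i _; rewrite sub0set cards0.
- by move=> i i' x; rewrite inE.
- have := cardsID Bty Q; have := subset_leq_card (subsetIr Q Bty).
  move: cQ cB kb bu cBty; rewrite /e /l; clear; nia.
have PQ i x : (i < 2 * j.+1)%N -> x \in P i -> x \in Q /\ x \notin Bty.
  by move=> ij xi; have [_ /subsetP/(_ x xi) + _] := HP i ij; rewrite inE => /andP[].
have cP i : (i < 2 * j.+1)%N -> #|P i| = (2 * e)%N by move=> ij; have [] := HP i ij.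
pose D i := if i == 0%N then X else P i.
have dD : disjoint_upto D j.+1.
  move=> [|i] [|i'] x ij i'j //; rewrite /D /=.
  - by move=> xX /PQ[|xQ _]; [exact: lt2|]; move/disjointFr: dXQ => /(_ x xX); rewrite xQ.
  - by move=> /PQ[|xQ _]; [exact: lt2|] => xX; move/disjointFr: dXQ => /(_ x xX); rewrite xQ.
  - by apply: dP; apply: lt2.
have dYD i : (i <= j)%N -> [disjoint Y & D i].
  case: i => [|i] ij; first by rewrite disjoint_sym.
  apply: disjointWr dYQ; by apply/subsetP=> x /PQ[|//]; apply: lt2.
have [C HC] : exists C : nat -> {set V}, forall i, (i <= j)%N ->
    C i \subset P (j.+1 + i)%N /\ #|C i| = (2 * u)%N.
  have ex i : exists Ci : {set V}, (i <= j)%N -> Ci \subset P (j.+1 + i)%N /\ #|Ci| = (2 * u)%N.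
    case: (leqP i j) => ij; last by exists set0.
    have [|Ci cC CP] := @subset_of_card _ (P (j.+1 + i)%N) (2 * u).
      by rewrite cP ?lt2' // leq_mul2l ue.
    by exists Ci.
  by exists (fun i => projT1 (cid (ex i))) => i; apply: (projT2 (cid (ex i))).
have dC : disjoint_upto C j.+1.
  move=> i i' x ij i'j xi xi'.
  have [/subsetP/(_ x xi) x1 _] := HC i ij; have [/subsetP/(_ x xi') x2 _] := HC i' i'j.
  by apply: (@addnI j.+1); apply: (dP _ _ x) => //; apply: lt2'.
pose bad1 := some_missed (@sparse_pair V u) (fun q => setX q.1 q.2).
pose bad2 i := some_missed (narrow_pair (P i) e) (fun q => setX q.1 (P i :\: q.2)).
pose bad3 i := some_missed (narrow_pair (C i) u) (fun q => setX q.1 (C i :\: q.2)).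
(* For [k' = 0] no cycle has to be closed, yet [unclosed] could hold trivially because there may be
   no closing pairs; hence the guard. *)
pose bad4 H := (0 < k')%N && unclosed G D Y j k' H.
pose bad H := [|| bad1 H, [exists i : 'I_j.+1, bad2 i H], [exists i : 'I_j.+1, bad3 i H] | bad4 H].
set sigma := ((1 + z) ^+ #|V| - 1) * (1 + z) ^+ #|V|.
apply: (prob_le_good (bad := bad)) => //.
  move=> H HP2; rewrite /bad !negb_or => /and4P[b1 b2 b3 b4].
  move: b2 b3; rewrite negb_exists => /forallP b2; rewrite negb_exists => /forallP b3.
  set r := union_rel G H; set h := edge_rel H.
  have hC : symmetric h by apply: edge_rel_sym.
  have rC : symmetric r.
    by move=> x y; rewrite /r /union_rel eq_sym GC setUC.
  have Gr : subrel G r.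
    by move=> x y Gxy; rewrite /r /union_rel Gxy andbT; apply: contraTneq Gxy => ->; rewrite GI.
  have hr : subrel h r.
    move=> x y hxy; rewrite /r /union_rel [_ \in H]hxy orbT andbT.
    by have := subsetP HP2 _ hxy; rewrite inE cards2; case: (x != y).
  have hd : joins_large h u := joins_large_edge_rel b1.
  have [cs0 [ccs0 scs0 mcs0]] : exists cs, [/\ cycle_family r l cs, size cs = k' &
      {in flatten cs, forall x, x \in Y \/ exists2 i, (i <= j)%N & x \in D i}].
    case: (posnP k') => [->|k'0]; first by exists [::].
    apply: (closed_cycles (k := k') dYD GC hr Gr dD).
      apply: (random_chain hC hd ue dD cX) => i /andP[i0 ij].
      have -> : D i = P i by case: i i0 {ij}.
      split; first by rewrite cP ?lt2.
      exact: expands_edge_rel (b2 (Ordinal (ij : (i < j.+1)%N))).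
    by move: b4; rewrite /bad4 k'0.
  suff [cs [ccs scs]] : exists cs, cycle_family r l cs /\ size cs = m by apply: Hgood ccs scs.
  apply: (@cycles_assembly V h G r A B Hub C j u b k k' t m cs0) => //.
  - by rewrite -setI_eq0 setICr.
  - by rewrite setUCr.
  - by apply: leq_trans cB; rewrite /l; clear; nia.
  - move=> i ij; have [CP cC] := HC i ij; split; last 1 first.
    + exact: expands_edge_rel (b3 (Ordinal (ij : (i < j.+1)%N))).
    + apply/subsetP=> x /(subsetP CP)/PQ[|xQ xB]; first exact: lt2'.
      by have := subsetP QB x xQ; rewrite !in_setD !in_setU negb_or xB andbT.
    + by rewrite cC.
  - move=> x /mcs0 H0.
    have CQ i : (i <= j)%N -> x \in C i -> x \in Q.
      by move=> ij xi; have [/subsetP/(_ x xi) + _] := HC i ij; case/PQ=> //; apply: lt2'.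
    case: H0 => [xY|[i ij]].
      split; first exact: (subsetP YB).
      move=> i ij; apply/negP=> /(CQ i ij) xQ.
      by move/disjointFr: dYQ => /(_ x xY); rewrite xQ.
    rewrite /D; case: eqP => [_ xX|i0 xP].
      split; first exact: (subsetP XB).
      move=> i' i'j; apply/negP=> /(CQ i' i'j) xQ.
      by move/disjointFr: dXQ => /(_ x xX); rewrite xQ.
    split; first by apply: (subsetP QB); case: (PQ i x) => //; apply: lt2.
    move=> i' i'j; apply/negP=> xC; have [/subsetP/(_ x xC) xP' _] := HC i' i'j.
    have E := dP i (j.+1 + i')%N x (lt2 _ ij) (lt2' _ i'j) xP xP'.
    by move: ij; rewrite E; clear; lia.
(* One event for joining large sets and [j + 1] for each of the two families of expansions give
   [2 * j + 3] copies of [sigma]; the last term is for closing. *)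
apply: (@le_trans _ _ (sigma + (sigma *+ j.+1 + (sigma *+ j.+1 + z * (1 + z) ^+ #|V|)))); last first.
  by rewrite !addrA -mulrS -mulrnDr (_ : (j.+2 + j.+1 = 2 * j + 3)%N) //; clear; lia.
have qe : (1 - p) ^+ e <= z ^+ 2 by apply: le_trans qz; rewrite ler_wiXn2l.
apply: le_trans (prob_union (F1 := bad1) (F2 := fun H => [|| [exists i : 'I_j.+1, bad2 i H],
  [exists i : 'I_j.+1, bad3 i H] | bad4 H]) p01 _) _; first by move=> H _.
apply: lerD; first exact: prob_sparse_pair.
have sum_const (f : 'I_j.+1 -> pred {set {set V}}) :
    (forall i, prob [set e : {set V} | #|e| == 2%N] p (f i) <= sigma) ->
    prob [set e : {set V} | #|e| == 2%N] p (fun H => [exists i, f i H]) <= sigma *+ j.+1.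
  move=> Hf; apply: le_trans (prob_exists (A := xpredT) (B := f) p01 _) _.
    by move=> H _ /existsP[i fi]; exists i.
  by rewrite -[j.+1 in leRHS]card_ord -sumr_const; apply: ler_sum => i _.
apply: le_trans (prob_union (F1 := fun H => [exists i : 'I_j.+1, bad2 i H])
  (F2 := fun H => [exists i : 'I_j.+1, bad3 i H] || bad4 H) p01 _) _; first by move=> H _.
apply: lerD.
  by apply: sum_const => i; apply: prob_narrow_pair => //; rewrite cP ?lt2 // -ltnS.
apply: le_trans (prob_union (F1 := fun H => [exists i : 'I_j.+1, bad3 i H])
  (F2 := bad4) p01 _) _; first by move=> H _.
apply: lerD.
  by apply: sum_const => i; apply: prob_narrow_pair => //; have [] := HC i (ltn_ord i).
case: (posnP k') => [k'0|k'0].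
  rewrite /bad4 k'0 /prob big1 ?mulr_ge0 ?exprn_ge0 ?addr_ge0 //.
  by move=> H; rewrite /= andbF.
apply: (@le_trans _ _ (prob [set e : {set V} | #|e| == 2%N] p (unclosed G D Y j k'))).
  by rewrite /prob /bad4 k'0.
apply: (@prob_unclosed V G D Y j k' dYD R p z (u * (2 * k').+1)%N) => //.
  move=> U cU; rewrite /D eqxx.
  have := edges_setD GC dXY degX degY cU.
  move: eXY k'0; rewrite /e /l; clear; nia.
rewrite exprM; apply: (@le_trans _ _ ((z ^+ 2) ^+ (2 * k').+1)).
  by apply: lerXn2r; rewrite ?nnegrE ?exprn_ge0.
by rewrite -exprM ler_wiXn2l // leq_pmull.
Qed.

(** * Choice of the parameters *)

(* [c * n] is the size from which two sets are joined by a random edge. *)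
Lemma parameters_exist (R : realFieldType) (L a0 : R) : 3 <= L -> 0 < a0 ->
  exists c beta : R, [/\ 0 < c, 0 < beta, 200 * (100 * (c * L * L)) = a0, 16 * (10 * (beta * L)) = c & beta < a0].
Proof.
move=> L3 a00; have L0 : 0 < L by lra.
have LL : 0 < L * L * 100 * 200 by have := mulr_gt0 L0 L0; lra.
have L160 : 0 < L * 10 * 16 by lra.
have c0 := divr_gt0 a00 LL; have b0 := divr_gt0 c0 L160.
have cE := divfK (lt0r_neq0 LL) a0; have bE := divfK (lt0r_neq0 L160) (a0 / (L * L * 100 * 200)).
move: c0 b0 cE bE; set c := a0 / _; set beta := c / _; move: c beta => c beta c0 b0 cE bE.
exists c, beta; split=> //; [lra | lra |].
have h1 : beta * 3 <= beta * L by rewrite ler_pM2l.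
have h2 : c * 3 <= c * L by rewrite ler_pM2l.
have h3 : c * L * 3 <= c * L * L by rewrite ler_pM2l // mulr_gt0.
lra.
Qed.

(** Here [u] and [b] are the integer parts of [c * n] and [4 * (beta * n)]. The factor 4 leaves room
    for [a - m <= 2 * (beta * n) + 1] and for rounding, as [beta * n >= 1]. *)
Lemma parameters_bounds (R : realFieldType) (L c beta a0 alpha n a B m u b : R) :
  3 <= L -> 0 < c -> 200 * (100 * (c * L * L)) = a0 -> 16 * (10 * (beta * L)) = c ->
  a0 <= alpha -> L * alpha <= 1 -> 1 <= n -> 1 <= beta * n ->
  u <= c * n -> c * n < u + 1 -> b <= 4 * (beta * n) -> 4 * (beta * n) < b + 1 ->
  m <= alpha * n -> (alpha - beta) * n - 1 <= m ->
  (alpha - beta) * n <= a -> a <= (alpha + beta) * n -> (1 - alpha - beta) * n <= B ->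
  [/\ [/\ m <= a + b, a <= m + b & 20 * L * b <= u],
      [/\ forall x, alpha * n / 4 <= x -> 16 * L * u <= x, 48 * L * u <= a &
          16 * (L * (32 * (16 * (L * u)))) <= B] &
      [/\ 0 < u, beta * n <= b, L * m <= n & 4 * n <= 8 / c * u]].
Proof.
move=> L3 c0 cE bE a0a La n1 s1 u1 u2 b1 b2 m1 m2 A1 A2 B1.
have n0 : 0 <= n by lra.
have L0 : 0 <= L by lra.
have wv : 200 * (100 * (L * (L * (c * n)))) <= alpha * n.
  apply: le_trans (ler_wpM2r n0 a0a); rewrite -cE; lra.
have vE : 16 * (10 * (L * (beta * n))) = c * n by rewrite -bE; lra.
have nw : L * (alpha * n) <= n by have := ler_wpM2r n0 La; lra.
rewrite mulrBl in m2; rewrite mulrBl in A1; rewrite mulrDl in A2.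
have {}B1 : n - alpha * n - beta * n <= B by move: B1; clear; lra.
move: A1 A2 B1 m2.
(* The products with [n] become atoms; with the products by [L] supplied below, linear arithmetic
   finishes. *)
move: (beta * n) (alpha * n) wv vE nw s1 b1 b2 m1 => s w.
move Ev : (c * n) u1 u2 => v u1 u2 wv vE nw s1 b1 b2 m1 A1 A2 B1 m2.
have Ls : 3 * s <= L * s by rewrite ler_wpM2r //; lra.
have v0 : 0 <= v by lra.
have Lv : 3 * v <= L * v by rewrite ler_wpM2r.
have LLv : 3 * (L * v) <= L * (L * v) by rewrite ler_wpM2r //; lra.
have Lu : L * u <= L * v by rewrite ler_wpM2l.
have LLu : L * (L * u) <= L * (L * v) by rewrite ler_wpM2l.
have Lb : L * b <= L * (4 * s) by rewrite ler_wpM2l.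
have Lm : L * m <= L * w by rewrite ler_wpM2l.
have w0 : 0 <= w by lra.
have Lw : 3 * w <= L * w by rewrite ler_wpM2r.
split; split; try lra.
- by move=> x wx; lra.
- by rewrite mulrAC ler_pdivlMr //; lra.
Qed.

From mathcomp Require Import all_classical all_reals all_analysis.
Import Order.TTheory GRing.Theory Num.Theory.

(** * Translation to the statement, asymptotic estimates and conclusion *)

Lemma has_disjoint_cycles_family n (G : rel 'I_n) m l cs :
  (0 < l)%N -> cycle_family G l cs -> size cs = m -> has_disjoint_cycles G m l.
Proof.
move=> l0 ccs scs; case/andP: (ccs) => /allP acs ucs.
have Hc i : (i < m)%N -> size (nth [::] cs i) = l /\ cycle G (nth [::] cs i).
  by move=> im; have /acs/andP[/eqP] : nth [::] cs i \in cs by rewrite mem_nth ?scs.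
(* For [m = 0] there may be no vertex at all to serve as default for [nth], so the function on the
   empty type is given directly. *)
case: (posnP m) => [m0|m0].
  subst m.
  have x0 (x : 'I_(size cs) * 'I_l) : False by case: x => -[i]; rewrite m0.
  apply/existsP; exists [ffun x => False_rect 'I_n (x0 x)].
  by apply/andP; split; [apply/injectiveP=> x | apply/forallP=> x]; case: (x0 x).
have [v0 _] : exists v : 'I_n, true.
  have [] := Hc 0%N m0; case: (nth _ _ _) => [|v s _ _]; first by move=> /= E; rewrite -E in l0.
  by exists v.
apply/existsP; exists [ffun x : 'I_m * 'I_l => nth v0 (nth [::] cs x.1) x.2].
apply/andP; split.
  apply/injectiveP=> -[i a] [i' a']; rewrite !ffunE /= => E.
  have [si _] := Hc i (ltn_ord i); have [si' _] := Hc i' (ltn_ord i').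
  have ii : i = i'.
    apply/val_inj/(uniq_flatten_nth (x := nth v0 (nth [::] cs i) a) ucs).
      by rewrite mem_nth ?si.
    by rewrite E mem_nth ?si'.
  subst i'; congr (_, _); apply/val_inj/eqP.
  have ui : uniq (nth [::] cs i).
    move: ucs; rewrite -{1}(cat_take_drop i cs) (drop_nth [::]) ?scs // flatten_cat /=.
    by rewrite !cat_uniq => /and3P[_ _ /and3P[]].
  by have := @nth_uniq _ v0 _ a a' _ _ ui; rewrite si E eqxx => <-.
apply/forallP=> -[i a]; rewrite !ffunE /=.
have [si ci] := Hc i (ltn_ord i); rewrite -[X in (_ %% X)%N]si.
by apply: cycle_nth; rewrite ?si.
Qed.

Lemma mindeg_le n (G : rel 'I_n) u : (mindeg G <= deg G u)%N.
Proof.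
rewrite /mindeg; have := mem_index_enum u; elim: (index_enum _) => //= v s IH.
rewrite inE big_cons => /orP[/eqP->|/IH]; first exact: geq_minl.
by apply: leq_trans; apply: geq_minr.
Qed.

(** The default [n] of the minimum must also be at least [x]. *)
Lemma le_mindeg (R : realDomainType) n (G : rel 'I_n) (x : R) : x <= n%:R ->
  (forall u, x <= (deg G u)%:R) -> x <= (mindeg G)%:R.
Proof.
move=> xn xd; rewrite /mindeg; apply: (big_ind (fun a : nat => x <= a%:R)) => // a b xa xb.
by rewrite /minn; case: ifP.
Qed.

(** From [1 - x <= expR (- x)] one gets [(1 - x) * expR x <= 1], and [(1 - x) * (1 + 2 * x) >= 1] on
    this interval. *)
Lemma expR_le_1D2x (R : realType) (x : R) : 0 <= x <= 2^-1 -> expR x <= 1 + 2 * x.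
Proof.
move=> /andP[x0 x1]; have : (1 - x) * expR x <= 1.
  rewrite [leRHS](_ : _ = expR (- x) * expR x); last by rewrite -expRD addNr expR0.
  by rewrite ler_wpM2r ?expR_ge0 // expR_ge1Dx.
have := expR_ge0 x; nra.
Qed.

(** For [z = n ^- 2] the power [(1 + z) ^+ n] is at most [expR (1 / n) <= 1 + 2 / n]. Each of the
    [2 * j + 3] terms is then at most [4 / n], and the last one at most [2 / n]. *)
Lemma union_bound_small (R : realType) (n j : nat) (z : R) : (2 <= n)%N -> z = n%:R ^- 2 ->
  ((1 + z) ^+ n - 1) * (1 + z) ^+ n *+ (2 * j + 3)%N + z * (1 + z) ^+ n <=
  (8 * j + 14)%N%:R / n%:R.
Proof.
move=> n2 ->; set x : R := n%:R^-1.
have n2r : 2 <= n%:R :> R by rewrite ler_nat.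
have n0 : 0 < n%:R :> R by lra.
have x0 : 0 < x by rewrite invr_gt0.
have x2 : x <= 2^-1 by rewrite lef_pV2 ?posrE; lra.
have nx : n%:R * x = 1 by rewrite mulfV // gt_eqF.
have -> : n%:R ^- 2 = x ^+ 2 :> R by rewrite -exprVn.
set w := (1 + x ^+ 2) ^+ n.
have w1 : 1 <= w by rewrite exprn_ege1 // lerDl exprn_ge0 // ltW.
have w2 : w <= 1 + 2 * x.
  apply: le_trans (expR_le_1D2x _); last by rewrite (ltW x0).
  rewrite [in leRHS](_ : x = n%:R * x ^+ 2); last by rewrite expr2 mulrA nx mul1r.
  rewrite expRM_natl; apply: lerXn2r; rewrite ?nnegrE ?expR_ge0 ?expR_ge1Dx //.
  by rewrite addr_ge0 // exprn_ge0 // ltW.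
have h1 : (w - 1) * w <= 4 * x by nra.
have h2 : x ^+ 2 * w <= 2 * x by nra.
have -> : (8 * j + 14)%N%:R = 8 * j%:R + 14 :> R by rewrite natrD natrM.
rewrite -mulr_natr; have -> : (2 * j + 3)%N%:R = 2 * j%:R + 3 :> R by rewrite natrD natrM.
rewrite -/x; have := ler0n R j; nra.
Qed.

(** Use [1 - p <= expR (- p)] and [p * u >= 4 * ln n]. *)
Lemma expr_onem_le (R : realType) (n u : nat) (C p : R) : (0 < n)%N -> p <= 1 ->
  C * ln n%:R / n%:R <= p -> 4 * n%:R <= C * u%:R -> (1 - p) ^+ u <= (n%:R ^- 2) ^+ 2.
Proof.
move=> n0 p1 Cp Cu; have nr : 1 <= n%:R :> R by rewrite ler1n.
have n0r : 0 < n%:R :> R by lra.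
apply: (@le_trans _ _ (expR (- p) ^+ u)).
  by apply: lerXn2r; rewrite ?nnegrE ?subr_ge0 ?expR_ge0 // expR_ge1Dx.
have -> : (n%:R ^- 2) ^+ 2 = expR (- ln n%:R) ^+ 4 :> R.
  by rewrite expRN lnK ?posrE // -exprVn -exprM.
rewrite -!expRM_natr ler_expR !mulNr lerN2.
have l0 : 0 <= ln n%:R :> R by rewrite ln_ge0.
apply: (@le_trans _ _ (C * ln n%:R / n%:R * u%:R)); last by rewrite ler_wpM2r.
rewrite -[leRHS]mulrA [n%:R^-1 * _]mulrC mulrA ler_pdivlMr //.
rewrite [leRHS]mulrAC; nra.
Qed.

Theorem theorem1p5 (R : realType) (l : nat) (hl : (3 <= l)%N) (alpha0 : R)
  (ha0 : 0 < alpha0) (ha0l : alpha0 <= l%:R^-1) :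
  exists beta gamma C : R,
    [/\ 0 < beta, beta < alpha0, 0 < gamma & 0 < C] /\
    forall alpha : R, alpha0 <= alpha -> alpha <= l%:R^-1 ->
    forall eps : R, 0 < eps ->
    exists N : nat, forall n : nat, (N <= n)%N ->
    forall (G : rel 'I_n) (p : R),
      simple_graph G ->
      (forall u : 'I_n, (alpha - gamma) * n%:R <= (deg G u)%:R) ->
      stable G alpha beta ->
      C * ln (n%:R) / n%:R <= p -> p <= 1 ->
      1 - eps <= prob_Gnp p
        (fun H => has_disjoint_cycles (union_graph G H)
                    (minn (mindeg G) (Num.truncn (alpha * n%:R))) l).
Proof.
(* Write [l = j + 2]: a cycle is one vertex plus a path through [j + 1] classes, and [l >= 3] gives
   [j > 0]. *)
case: l hl ha0l => [//|[//|j]] hl; have j0 : (0 < j)%N by [].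
have [L LE] : exists L : R, L = j.+2%:R by exists j.+2%:R.
rewrite -LE => ha0l.
have L3 : 3 <= L by rewrite LE ler_nat.
have [c [beta [c0 b0 cE bE ba]]] := parameters_exist L3 ha0.
have L0 : L != 0 by apply: lt0r_neq0; apply: lt_le_trans L3.
(* With [gamma = beta] the number of cycles stays within [beta * n + 1] of [alpha * n]. The constant
   [8 / c] yields [C * u >= 4 * n], since [u] is at least half of [c * n]. *)
exists beta, beta, (8 / c); split; first by rewrite divr_gt0.
move=> alpha a0 al eps eps0.
(* The three summands ensure [beta * n >= 1], failure probability at most [eps], and [n >= 2]. *)
pose N := ((Num.truncn beta^-1).+1 + (Num.truncn ((8 * j + 14)%N%:R / eps)).+1 + 2)%N.
exists N => n nN G p [GC GI] Gdeg [A [[cA1 cA2] [cB1 _] [degA degB] [Aty Bty] _]] pC p1.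
have n2 : (2 <= n)%N by apply: leq_trans nN; rewrite /N leq_addl.
have N1 : ((Num.truncn beta^-1).+1 <= n)%N.
  by apply: leq_trans nN; rewrite /N -addnA leq_addr.
have N2 : ((Num.truncn ((8 * j + 14)%N%:R / eps)).+1 <= n)%N.
  by apply: leq_trans nN; rewrite /N addnAC leq_addl.
have [nr nE] : exists nr : R, nr = n%:R by exists n%:R.
rewrite -nE in Gdeg cA1 cA2 cB1 degA degB Aty Bty pC *.
have nr1 : 1 <= nr by rewrite nE ler1n ltnW.
have nr0 : 0 < nr by apply: lt_le_trans nr1.
have bn : 1 <= beta * nr.
  rewrite -(mulfV (lt0r_neq0 b0)); apply: ler_wpM2l; first exact: ltW.
  by apply: le_trans (ltW (truncnS_gt _)) _; rewrite nE ler_nat.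
have epsn : (8 * j + 14)%N%:R / nr <= eps.
  rewrite ler_pdivrMr // mulrC -ler_pdivrMr //.
  by apply: le_trans (ltW (truncnS_gt _)) _; rewrite nE ler_nat.
have La : L * alpha <= 1 by rewrite -(mulfV L0) ler_wpM2l // (le_trans _ L3).
pose u := Num.truncn (c * nr); pose b := Num.truncn (4 * (beta * nr)).
pose m := minn (mindeg G) (Num.truncn (alpha * nr)).
have alpha0' : 0 <= alpha by apply: le_trans a0; apply: ltW.
have /andP[u1 u2] : u%:R <= c * nr < u.+1%:R by apply: truncn_itv; rewrite mulr_ge0 ?ltW.
have /andP[b1 b2] : b%:R <= 4 * (beta * nr) < b.+1%:R.
  by apply: truncn_itv; rewrite !mulr_ge0 ?ltW.
have /andP[m1 m2] : (Num.truncn (alpha * nr))%:R <= alpha * nr < (Num.truncn (alpha * nr)).+1%:R.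
  by apply: truncn_itv; rewrite mulr_ge0 // ltW // mulr_gt0.
rewrite -[u.+1%:R]natr1 in u2; rewrite -[b.+1%:R]natr1 in b2; rewrite -[_.+1%:R]natr1 in m2.
have bnr : 0 <= beta * nr by apply: le_trans bn.
have am1 : (alpha - beta) * nr - 1 <= m%:R.
  rewrite /m /minn; case: ifP => _; last first.
    by rewrite mulrBl; move: m2 bnr; clear; lra.
  have : (alpha - beta) * nr <= (mindeg G)%:R.
    apply: le_mindeg => //; rewrite -nE mulrBl.
    have := ler_wpM2r (ltW nr0) La; rewrite mul1r -mulrA.
    have := ler_wpM2r (mulr_ge0 alpha0' (ltW nr0)) L3.
    by have := mulr_ge0 alpha0' (ltW nr0); move: bnr; clear; lra.
  by clear; lra.
have m_le : m%:R <= alpha * nr by apply: le_trans m1; rewrite ler_nat geq_minr.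
have [[k_le t_le bu] [D16 A48 B16] [u0 bnb Lm Cu]] :=
  parameters_bounds L3 c0 cE bE a0 La nr1 bn u1 u2 b1 b2 m_le am1 cA1 cA2 cB1.
apply: le_trans (_ : 1 - (8 * j + 14)%N%:R / nr <= _); first by rewrite lerD2l lerN2.
apply: le_trans (_ : 1 - (((1 + nr ^- 2) ^+ n - 1) * (1 + nr ^- 2) ^+ n *+ (2 * j + 3)%N
  + nr ^- 2 * (1 + nr ^- 2) ^+ n) <= _).
  by rewrite lerD2l lerN2 nE; apply: union_bound_small.
have z0 : 0 <= nr ^- 2 by rewrite invr_ge0 exprn_ge0 // ltW.
have z1 : nr ^- 2 <= 1 by rewrite invf_le1 ?exprn_gt0 // exprn_ege1.
have natL (x y : nat) (X Y : R) : X = x%:R -> Y = y%:R -> X <= Y -> (x <= y)%N.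
  by move=> -> ->; rewrite ler_nat.
(* Truncated subtraction gives the deficit [k = m - #|A|] and the surplus [t = #|A| - m], at least
   one of which is 0. The conclusion matches [prob_Gnp] by unfolding. *)
have := @random_cycles R 'I_n G A j u b (m - #|A|)%N (#|A| - m)%N m p (nr ^- 2)
  (fun H => has_disjoint_cycles (union_graph G H) m j.+2); rewrite !card_ord.
apply=> //.
- by move=> x; apply/negbTE/GI.
- by rewrite -(ltr_nat R).
- by apply: natL bu; rewrite ?LE // !natrM.
- by move=> x /degA/D16; apply: natL; rewrite ?LE // !natrM.
- by move=> x /degB/D16; apply: natL; rewrite ?LE // !natrM.
(* As [m] is at most the minimum degree, at least [m - #|A|] neighbours of any vertex lie in [B]. *)
- move=> x _; rewrite leq_subLR.
  apply: leq_trans (geq_minl _ _) _; apply: leq_trans (mindeg_le G x) _.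
  have : [set v | G x v] \subset A :|: [set y in ~: A | G x y].
    by apply/fintype.subsetP=> v; rewrite !inE => ->; rewrite andbT orbN.
  by move/subset_leq_card/leq_trans; apply; rewrite cardsU leq_subr.
- by apply: natL A48; rewrite ?LE // !natrM.
- apply: natL B16; last by [].
  by rewrite (_ : 512 = 32 * 16)%N // !natrM LE !mulrA.
(* Since [beta * nr <= b], a vertex atypical for [b] is also exceptional in the sense of
   stability. *)
- rewrite -(ler_nat R); apply: (le_trans _ bnb); apply: le_trans Aty.
  rewrite ler_nat; apply/subset_leq_card/fintype.subsetP=> x; rewrite !inE => /andP[-> /=].
  by rewrite -(ltr_nat R) natrD /degin => deg_lt; rewrite ltrBrDr; apply: le_lt_trans deg_lt; rewrite lerD2l.
- rewrite -(ler_nat R); apply: (le_trans _ bnb); apply: le_trans Bty.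
  rewrite ler_nat; apply/subset_leq_card/fintype.subsetP=> x; rewrite !inE => /andP[-> /=].
  by rewrite -(ltr_nat R) natrD /degin => deg_lt; rewrite ltrBrDr; apply: le_lt_trans deg_lt; rewrite lerD2l.
- by rewrite leq_subLR -(ler_nat R) natrD.
- by rewrite leq_subLR -(ler_nat R) natrD.
- by rewrite -maxnE -maxnE maxnC.
- by apply: natL Lm; rewrite ?LE // natrM.
- rewrite p1 andbT; apply: le_trans pC.
  by rewrite divr_ge0 ?(ltW nr0) // mulr_ge0 ?ln_ge0 // divr_ge0 // ltW.
- rewrite nE in pC Cu *; apply: (expr_onem_le _ p1 pC Cu); exact: ltnW.
- by move=> H cs ccs scs; apply: has_disjoint_cycles_family ccs scs.
Qed.
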